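(* Let $\varepsilon>0$, let $X_1,\dots,X_N$ be complete separable metric spaces, $c_N:X_1\times\dots\times X_N\to\mathbb{R}$ a bounded cost function, $\Phi$ an Entropy, $\Psi=\Phi^*$, and $\rho_i\in\mathcal{P}(X_i)$, $i\in\{1,\dots,N\}$, probability measures. Then, given $u_i^*\in L^{\Phi}_{\varepsilon}(\rho_i)$, $i\in\{1,\dots,N\}$, the following are equivalent: (1) (Maximizers) $u_1^*,\dots,u_N^*$ are maximizing potentials for the dual problem $\max\{D^N_{\varepsilon}(u_1,\dots,u_N):u_i\in L^{\Phi}_{\varepsilon}(\rho_i),\ i\in\{1,\dots,N\}\}$; (2) (Maximality condition) $\mathcal{F}_i^{(N,c,\varepsilon,\Phi)}(\hat u_i^* )=u_i^*$ and $u_i^*\in L^\infty(\rho_i)$ for all $i\in\{1,\dots,N\}$, where $\hat u_i^*=(u_1^*,\dots,u_{i-1}^*,u_{i+1}^*,\dots,u_N^* )$; (3) (Minimizer) letting $\gamma^*=\Psi'\big((\sum_{i=1}^N u_i^*(x_i)-c_N(x_1,\dots,x_N))/\varepsilon\big)\cdot\rho^N$, one has $\gamma^*\in\Pi_N(\rho_1,\dots,\rho_N)$; (4) (Complementary slackness) $\mathrm{OT}^N_{\varepsilon}(\rho_1,\dots,\rho_N)=D^N_{\varepsilon}(u_1^*,\dots,u_N^* )$. Moreover, in those cases $\gamma^*$, as defined in (3), is also the (unique) minimizer of the problem defining $\mathrm{OT}^N_{\varepsilon}(\rho_1,\dots,\rho_N)$.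
   Context: An Entropy is a function $\Phi:[0,+\infty]\to[0,+\infty]$ that is convex, lower semi-continuous, superlinear at infinity, with $\Phi\in C^1((0,\infty))$ and $\Phi(1)=\Phi'(1)=0$. $\Psi=\Phi^*$ is its Legendre conjugate and $\Psi'$ its derivative. Write $\rho^N=\otimes_{i=1}^N\rho_i$; $\Pi_N(\rho_1,\dots,\rho_N)$ is the set of probability measures on $X_1\times\dots\times X_N$ with $i$-th marginal $\rho_i$ for every $i$. The multi-marginal problem is $$\mathrm{OT}^N_{\varepsilon}(\rho_1,\dots,\rho_N)=\min_{\gamma\in\Pi_N(\rho_1,\dots,\rho_N)}\int c_N\,d\gamma+\varepsilon\int\Phi\Big(\frac{d\gamma}{d\rho^N}\Big)d\rho^N,$$ the last integral being $+\infty$ if $\gamma$ is not absolutely continuous with respect to $\rho^N$. $L^{\Phi}_{\varepsilon}(\rho_i)$ is the set of measurable $u:X_i\to[-\infty,\infty)$ with $0<\int_{X_i}\Psi(u/\varepsilon)\,d\rho_i<\infty$. The dual functional is $$D^N_{\varepsilon}(u_1,\dots,u_N)=\sum_{i=1}^N\int_{X_i}u_i\,d\rho_i-\varepsilon\int_{X_1\times\dots\times X_N}\Psi\Big(\frac{\sum_{i=1}^N u_i(x_i)-c_N}{\varepsilon}\Big)d\rho^N.$$ For $\hat u_i=(u_1,\dots,u_{i-1},u_{i+1},\dots,u_N)$ with $u_j\in L^{\Phi}_{\varepsilon}(\rho_j)$, the transform is $\mathcal{F}_i^{(N,c,\varepsilon,\Phi)}(\hat u_i)\in\operatorname{argmax}\{D^N_{\varepsilon}(u_1,\dots,u_N):u_i\in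 L^{\Phi}_{\varepsilon}(\rho_i)\}$. Functions are identified up to null sets.
   Formalization: The formal theorem assumes Ψ differentiable on the whole real line (i.e. Φ strictly convex), as the notation Ψ' presupposes; otherwise, e.g. for Φ=0 on [1/2,3/2] and c_N constant and positive, Ψ'(0) is undefined and the minimizer is not unique. *)

(* Defs.v *)
From HB Require Import structures.
From mathcomp Require Import all_boot all_order all_algebra.
From mathcomp Require Import all_classical all_reals all_analysis.
From mathcomp Require Import measurable_realfun ess_sup_inf.

Set Implicit Arguments.
Unset Strict Implicit.
Unset Printing Implicit Defensive.

Import Order.TTheory GRing.Theory Num.Theory.
Import numFieldNormedType.Exports.

Local Open Scope classical_set_scope.
Local Open Scope ring_scope.
Local Open Scope ereal_scope.

#[short(type="completeMetricType")]
HB.structure Definition CompleteMetric (R : numDomainType) :=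
  {T of Complete T & Metric R T}.

Definition separable (T : topologicalType) :=
  exists2 D : set T, countable D & dense D.

Notation borel T := (g_sigma_algebraType (@open T)).

(* The product sigma-algebra is the one generated by the coordinates. On a
   finite product of separable metric spaces it is the Borel sigma-algebra. *)
Section product_space.
Context {n : nat} {d : 'I_n -> measure_display}.
Variable T : forall i, measurableType (d i).

Definition cylinders : set (set (forall i, T i)) :=
  [set B | exists i, exists2 A : set (T i),
     measurable A & B = [set x | A (x i)]].

Local Notation prod_space := (g_sigma_algebraType cylinders).

Lemma measurable_coord (i : 'I_n) :
  measurable_fun [set: prod_space] (fun x : prod_space => x i).
Proof.
by move=> _ A mA; rewrite setTI; apply: sub_sigma_algebra; exists i, A.
Qed.

Lemma measurable_fun_prod_space d' (S : measurableType d')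
    (f : S -> prod_space) :
  (forall i, measurable_fun [set: S] (fun s => f s i)) ->
  measurable_fun [set: S] f.
Proof.
move=> mf; apply: measurability; first by [].
move=> _ [_ [i [A mA ->]] <-]; rewrite setTI.
by rewrite -[X in measurable X]setTI; exact: (mf i).
Qed.

End product_space.
Arguments cylinders {n d} T.
Arguments measurable_coord {n d T}.

Notation prod_space T := (g_sigma_algebraType (cylinders T)).

Section cons_fun.
Context {n : nat} {d : 'I_n.+1 -> measure_display}.
Variable T : forall i, measurableType (d i).

Definition cons_fun
    (p : T ord0 * prod_space (fun i => T (lift ord0 i))) : prod_space T :=
  fun i => match unliftP ord0 i with
           | UnliftSome j e => ecast k (T k) (esym e) (p.2 j)
           | UnliftNone e => ecast k (T k) (esym e) p.1
           end.

Lemma cons_fun0 p : cons_fun p ord0 = p.1.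
Proof.
rewrite /cons_fun; case: (unliftP ord0 ord0) => [j|] e.
  by exfalso; move: (neq_lift ord0 j); rewrite -e eqxx.
by rewrite eq_axiomK.
Qed.

Lemma cons_funS p j : cons_fun p (lift ord0 j) = p.2 j.
Proof.
rewrite /cons_fun; case: (unliftP ord0 (lift ord0 j)) => [k|] e.
  by have /lift_inj jk := e; subst k; rewrite eq_axiomK.
by exfalso; move: (neq_lift ord0 j); rewrite e eqxx.
Qed.

Lemma measurable_cons_fun : measurable_fun setT cons_fun.
Proof.
apply: measurable_fun_prod_space => i; case: (unliftP ord0 i) => [j ->|->].
  rewrite (_ : (fun p => _) = (fun x => x j) \o snd); last first.
    by apply/funext => p; exact: cons_funS.
  exact: (measurableT_comp (measurable_coord j)).
rewrite (_ : (fun p => _) = fst); last by apply/funext => p; exact: cons_fun0.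
exact: measurable_fst.
Qed.

HB.instance Definition _ :=
  isMeasurableFun.Build _ _ _ _ cons_fun measurable_cons_fun.

End cons_fun.

Arguments cons_fun {n d} T p.

Section product_probability.
Context {R : realType}.

Definition prod_nil (d : 'I_0 -> measure_display)
    (T : forall i, measurableType (d i)) : prod_space T :=
  fun i => False_rect _ (notF (ltn_ord i)).

Fixpoint product_prob {n : nat} : forall (d : 'I_n -> measure_display)
    (T : forall i, measurableType (d i)),
    (forall i, probability (T i) R) -> probability (prod_space T) R :=
  match n with
  | 0 => fun d T _ => dirac (prod_nil T) : probability _ R
  | n'.+1 => fun d T P =>
      distribution (P ord0 \x product_prob (fun i => P (lift ord0 i)))
                   (cons_fun T) : probability _ R
  end.

Lemma measurable_box (n : nat) (d : 'I_n -> measure_display)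
    (T : forall i, measurableType (d i)) (A : forall i, set (T i)) :
  (forall i, measurable (A i)) ->
  measurable ([set x | forall i, A i (x i)] : set (prod_space T)).
Proof.
move=> mA; rewrite (_ : [set x | _] =
    \big[setI/setT]_(i < n) [set x : prod_space T | A i (x i)]).
  apply: bigsetI_measurable => i _; apply: sub_sigma_algebra.
  by exists i, (A i).
rewrite -bigcap_seq; apply/seteqP; split=> [x /= Ax i _|x Ax i].
  exact: Ax.
by apply: (Ax i); rewrite /= mem_index_enum.
Qed.

(* The property which characterizes the product measure. *)
Lemma product_probE (n : nat) (d : 'I_n -> measure_display)
    (T : forall i, measurableType (d i)) (P : forall i, probability (T i) R)
    (A : forall i, set (T i)) : (forall i, measurable (A i)) ->
  product_prob P [set x | forall i, A i (x i)] = \prod_(i < n) P i (A i).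
Proof.
elim: n d T P A => [|n IH] d T P A mA /=.
  by rewrite big_ord0 diracE mem_set// => -[].
rewrite big_ord_recl -(IH _ _ (fun i => P (lift ord0 i)))//.
rewrite -product_measure1E//; last first.
  exact: (measurable_box (A := fun i => A (lift ord0 i))).
rewrite /distribution /pushforward; congr (_ _).
apply/seteqP; split=> -[x y] /=.
  move=> Axy; split=> [|i]; first by have := Axy ord0; rewrite cons_fun0.
  by have := Axy (lift ord0 i); rewrite cons_funS.
move=> [/= Ax Ay] i; case: (unliftP ord0 i) => [j ->|->].
  by rewrite cons_funS.
by rewrite cons_fun0.
Qed.

End product_probability.

Section entropy.
Context {R : realType}.
Implicit Type Phi : \bar R -> \bar R.

(* Only the values of [Phi] on [0, +oo] matter. *)
Record is_entropy Phi : Prop := {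
  entropy_ge0 : forall t, 0 <= t -> 0 <= Phi t ;
  entropy_convex : forall x y (t : R), 0 <= x -> 0 <= y -> (0 <= t <= 1)%R ->
    Phi (t%:E * x + (1 - t)%:E * y) <= t%:E * Phi x + (1 - t)%:E * Phi y ;
  entropy_lsc :
    lower_semicontinuous (Phi : subspace [set t : \bar R | 0 <= t] -> \bar R) ;
  entropy_superlinear :
    Phi t%:E * (t^-1)%:E @[t --> +oo%R] --> +oo ;
  entropy_fin_num : forall t : R, (0 < t)%R -> Phi t%:E \is a fin_num ;
  entropy_derivable : forall t : R, (0 < t)%R ->
    derivable (fun s : R => fine (Phi s%:E)) t 1 ;
  entropy_C1 : forall t : R, (0 < t)%R ->
    {for t, continuous (derive1 (fun s : R => fine (Phi s%:E)))} ;
  entropy1 : Phi 1 = 0 ;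
  entropy_derive1 : derive1 (fun s : R => fine (Phi s%:E)) 1 = 0%R }.

(* Defined on extended reals because potentials may take the value -oo; with
   0 * -oo = 0, the value at -oo is - Phi 0 = lim_(s -> -oo) Psi s. *)
Definition conjugate Phi (s : \bar R) : \bar R :=
  ereal_sup [set t%:E * s - Phi t%:E | t in [set t : R | (0 <= t)%R]].

(* At -oo it is extended by 0, which is the limit of Psi' at -oo when [Phi] is
   finite on ]0, +oo[; the value at +oo is never used. *)
Definition conjugate' Phi (s : \bar R) : \bar R :=
  if s is r%:E then (derive1 (fun r : R => fine (conjugate Phi r%:E)) r)%:E
  else 0.

End entropy.

Section multimarginal.
Context {R : realType} {N : nat} {X : 'I_N -> completeMetricType R}.
Variables (c : (forall i, X i) -> R) (eps : R) (Phi : \bar R -> \bar R).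
Variable rho : forall i, probability (borel (X i)) R.

Local Notation XN := (prod_space (fun i => borel (X i))).
Local Notation rhoN := (product_prob rho).
Local Notation Psi := (conjugate Phi).
Local Notation Psi' := (conjugate' Phi).

Implicit Types (g : probability XN R) (u : forall i, X i -> \bar R).

Definition couplings : set (probability XN R) :=
  [set g | forall i (A : set (borel (X i))), measurable A ->
     g [set x | A (x i)] = rho i A].

(* Among the versions of dg/drho^N, [Radon_Nikodym_SigmaFinite.f] is one which
   is everywhere finite and nonnegative. *)
Definition divergence g : \bar R :=
  if `[< g `<< rhoN >]
  then \int[rhoN]_x Phi (Radon_Nikodym_SigmaFinite.f g rhoN x)
  else +oo.

Definition primal g : \bar R :=
  \int[g]_x (c x)%:E + eps%:E * divergence g.

Definition OT : \bar R := ereal_inf [set primal g | g in couplings].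

Definition primal_minimizer g :=
  couplings g /\ forall h, couplings h -> primal g <= primal h.

Definition potentials i : set (X i -> \bar R) :=
  [set v : X i -> \bar R |
     [/\ measurable_fun [set: borel (X i)] v, forall x, v x < +oo &
     0 < \int[rho i]_x Psi (v x * (eps^-1)%:E) < +oo]].

Definition slack u (x : forall i, X i) : \bar R :=
  (\sum_(i < N) u i (x i) - (c x)%:E) * (eps^-1)%:E.

Definition dual u : \bar R :=
  \sum_(i < N) \int[rho i]_x u i x - eps%:E * \int[rhoN]_x Psi (slack u x).

Definition dual_maximizer u :=
  (forall i, potentials (u i)) /\
  forall v, (forall i, potentials (v i)) -> dual v <= dual u.

(* The set depends on [u j] for [j != i] only. *)
Definition partial_argmax i u : set (X i -> \bar R) :=
  [set v : X i -> \bar R | potentials v /\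
     forall w : X i -> \bar R, potentials w ->
       dual (dfwith u i w) <= dual (dfwith u i v)].

Arguments partial_argmax : clear implicits.

(* A selection of the argmax. If the argmax is empty, the value is the constant
   -oo, which is neither in [potentials] nor essentially bounded. *)
Definition transform i u : X i -> \bar R :=
  xget (fun=> -oo) (partial_argmax i u).

(* g = Psi'((sum_i u_i - c) / eps) . rho^N as measures on the product
   sigma-algebra. *)
Definition is_gamma_star u g :=
  forall A : set XN, measurable A -> g A = \int[rhoN]_(x in A) Psi' (slack u x).

End multimarginal.

Arguments transform {R N X} c eps Phi rho i u x.
Arguments partial_argmax {R N X} c eps Phi rho i u.
Arguments potentials {R N X} eps Phi rho {i}.

(* Main.v *)
(* Every ingredient of the proof is reduced to finite potentials w_i, with
   s = (sum_i w_i - c) / eps, and to the integral over rho^N of the Young gap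
   Phi(f) + Psi(s) - f s >= 0, where f = dg/drho^N: for a coupling g, the primal
   value of g minus the dual value of w is eps times this integral. Hence weak
   duality; equality holds iff f = Psi'(s) a.e., which gives both the optimality
   and the uniqueness of gamma^*.

   For a maximizer, lowering u_i by t on a set A and letting t go to 0 shows
   that the i-th marginal of Psi'(s) rho^N is at most rho_i. Testing this
   inequality on a box where the other potentials are bounded below bounds u_i
   above, because Psi' is unbounded. Only then are upward perturbations
   admissible (Psi may grow so fast that Psi(s + t) is not integrable), and they
   give the reverse inequality, so gamma^* is a coupling. Conversely, since Psi'
   tends to 0 at -oo, the marginal condition bounds u_i below. Only values of
   rho^N on boxes are needed, never Fubini's theorem. *)
From HB Require Import structures.
Require Import Defs.
From mathcomp Require Import all_boot all_order all_algebra.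
From mathcomp Require Import all_classical all_reals all_analysis.
From mathcomp Require Import measurable_realfun ess_sup_inf.
From mathcomp Require Import ring lra.

Set Implicit Arguments.
Unset Strict Implicit.
Unset Printing Implicit Defensive.

Import Order.TTheory GRing.Theory Num.Theory.
Import numFieldNormedType.Exports.

Local Open Scope classical_set_scope.
Local Open Scope ring_scope.

(** * The Legendre conjugate of an entropy *)

Section subgradient.
Context {R : realType}.
Implicit Types (f : R -> R) (a s e : R).

(** Statements (1) and (2) enter the proof in the same way: every perturbation moves a single
    potential, so maximality in each coordinate separately already yields the marginal conditions.
    They differ in why the dual value is not [-oo]: a maximizer beats constant potentials, while in
    (2) this comes from boundedness. The delicate passage is from (1) to (2), because the transform
    selects some element of an argmax, which must be recognized as [u i]. Putting it in place of
    [u i] gives another maximizer with the same optimal coupling, and [Psi'] is injective where it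
    is positive because [Phi] is differentiable there. So the two potentials agree almost everywhere
    for the coupling, hence for its marginal [rho i]. Differentiability of [Psi], in turn, makes
    [Psi' s] the only point of equality in Young's inequality. The class of potentials is not stable
    under lowering, since [Psi] is nonpositive at negative arguments and its integral must stay
    positive; this is why downward perturbations have to be small. *)

Lemma derive1_approx f s e : derivable f s 1 -> 0 < e ->
  exists2 h : R, 0 < h &
    forall k, `|k| <= h -> `|f (s + k) - f s - k * derive1 f s| <= e * `|k|.
Proof.
move=> df e0; move: (df) => /cvg_ex[/= l fl].
have dl : derive1 f s = l.
  by rewrite derive1E /derive; exact/cvg_lim.
move/cvgrPdist_le : fl => /(_ _ e0) /nbhs_ballP[h /= h0 fh].
exists (h / 2); first by rewrite divr_gt0.
move=> k kh; have [->|k0] := eqVneq k 0.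
  by rewrite addr0 subrr mul0r subr0 normr0 mulr0.
have /= := fh k; rewrite /ball/= sub0r normrN dl; move=> /(_ _ k0).
have kh' : `|k| < h by rewrite (le_lt_trans kh)// ltr_pdivrMr// mulr_natr mulr2n ltrDl.
move=> /(_ kh'); rewrite scaler1 addrC -(ler_pM2r (_ : 0 < `|k|)) ?normr_gt0//.
rewrite -normrM; apply: le_trans; rewrite -normrN le_eqVlt; apply/orP; left; apply/eqP.
by congr (`|_|); rewrite /GRing.scale/= (addrC k s); field.
Qed.

(** A slope [a] other than the derivative is contradicted at [s + k] or [s - k] for small [k]. Only
    a local minorant is required, because for [Phi] Young's inequality is usable only near a
    positive point. *)
Lemma subgradient_derive1 f s a : derivable f s 1 ->
  (\forall x \near s, f s + a * (x - s) <= f x) -> derive1 f s = a.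
Proof.
move=> df /nbhs_ballP[r /= r0 fr].
apply/eqP/negPn/negP => /eqP Da.
have e0 : 0 < `|derive1 f s - a| / 2 by rewrite divr_gt0// normr_gt0 subr_eq0; apply/eqP.
have [h h0 fh] := derive1_approx df e0.
pose k := Num.min h (r / 2).
have k0 : 0 < k by rewrite lt_min h0 divr_gt0.
have kh : k <= h by rewrite ge_min lexx.
have kr : k < r.
  rewrite (@le_lt_trans _ _ (r / 2))// ?ge_min ?lexx ?orbT//.
  by rewrite ltr_pdivrMr// mulr_natr mulr2n ltrDl.
have f1 := fh k; have f2 := fh (- k).
rewrite normrN gtr0_norm// in f1 f2.
have {f1} := f1 kh; have {f2} := f2 kh.
have g1 : f s + a * k <= f (s + k).
  have := fr (s + k); rewrite addrAC subrr add0r; apply.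
  by rewrite /ball/= opprD addrA subrr sub0r normrN gtr0_norm.
have g2 : f s + a * - k <= f (s - k).
  have := fr (s - k); rewrite addrAC subrr add0r; apply.
  by rewrite /ball/= opprB addrC subrK gtr0_norm.
rewrite !ler_norml => /andP[_ u1] /andP[_ u2].
have {}u1 : (derive1 f s - a) * k <= `|derive1 f s - a| / 2 * k by nra.
have {}u2 : - (derive1 f s - a) * k <= `|derive1 f s - a| / 2 * k by nra.
have : `|derive1 f s - a| <= `|derive1 f s - a| / 2.
  rewrite -(ler_pM2r k0); case: (lerP 0 (derive1 f s - a)) => ?.
    by rewrite ger0_norm// in u1 *.
  by rewrite ltr0_norm// in u2 *.
lra.
Qed.

End subgradient.

Section conjugate_theory.
Context {R : realType}.
Variable Phi : \bar R -> \bar R.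
Hypothesis hPhi : is_entropy Phi.
Hypothesis dPsi :
  forall s : R, derivable (fun r : R => fine (conjugate Phi r%:E)) s 1.
Implicit Types (s t x y e : R).

Local Notation psi := (fun r : R => fine (conjugate Phi r%:E)).
Local Notation dpsi := (derive1 psi).

Lemma entropy_gtNy t : 0 <= t -> (-oo < Phi t%:E)%E.
Proof. by move=> t0; rewrite (lt_le_trans _ (entropy_ge0 hPhi _))// lee_fin. Qed.

Lemma conjugate_ge s t : 0 <= t -> (t%:E * s%:E - Phi t%:E <= conjugate Phi s%:E)%E.
Proof. by move=> t0; apply: ereal_sup_ubound; exists t. Qed.

(** The value at [t = 1] bounds the supremum below. Above, superlinearity makes [t s - Phi t]
    nonpositive for large [t], and for the other [t] the sign of [Phi] leaves only [t s] on a
    bounded interval. *)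
Lemma conjugate_fin_num s : conjugate Phi s%:E \is a fin_num.
Proof.
rewrite fin_numE; apply/andP; split; apply/eqP => Ps.
  have := conjugate_ge s ler01.
  by rewrite mul1e Ps entropy1// sube0 leeNy_eq.
have := entropy_superlinear hPhi => /cvgeyPge /(_ s)[T [_ hT]].
pose T1 := Num.max T 0.
suff : (conjugate Phi s%:E <= ((T1 + 1) * `|s|)%:E)%E by rewrite Ps leye_eq.
apply: ge_ereal_sup => _ [t /= t0 <-].
have T10 : 0 <= T1 by rewrite le_max lexx orbT.
have [tT|tT] := leP t (T1 + 1).
  apply: (@le_trans _ _ (t * s)%:E).
    by rewrite EFinM geeDl// leeNl oppe0 (entropy_ge0 hPhi)// lee_fin.
  rewrite lee_fin (le_trans (ler_norm _))// normrM (ger0_norm t0).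
  by rewrite ler_wpM2r.
have {}t0 : 0 < t by rewrite (le_lt_trans _ tT)// addr_ge0.
have /hT : T < t by rewrite (le_lt_trans _ tT)// (@le_trans _ _ T1)// ?lerDl// le_max lexx.
rewrite /= -(fineK (entropy_fin_num hPhi t0)) -!EFinM lee_fin ler_pdivlMr// => st.
rewrite -EFinB lee_fin (@le_trans _ _ 0)//; last by rewrite mulr_ge0// addr_ge0.
by rewrite subr_le0 mulrC.
Qed.

Lemma conjugateE s : conjugate Phi s%:E = (psi s)%:E.
Proof. by rewrite fineK// conjugate_fin_num. Qed.

Lemma young s t : 0 <= t -> ((t * s)%:E <= (psi s)%:E + Phi t%:E)%E.
Proof.
move=> t0; have := conjugate_ge s t0; rewrite conjugateE => H.
case: (Phi t%:E) (entropy_gtNy t0) H => [r _| |//].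
  by rewrite -!EFinM -!EFinB -EFinD !lee_fin lerBlDr.
by rewrite addey// leey.
Qed.

(* Since approximate maximizers converge to [Psi' s], lower semi-continuity alone
   makes [Psi' s] a maximizer, without any compactness argument. *)
Lemma conjugate_approx s e : 0 < e -> exists t, [/\ 0 <= t,
  (Phi t%:E <= (t * s - psi s + e)%:E)%E,
  forall y, psi s + t * (y - s) - e <= psi y & `|t - dpsi s| <= e].
Proof.
move=> e0; have e20 : 0 < e / 2 by rewrite divr_gt0.
have [h h0 dh] := derive1_approx (@dPsi s) e20.
(* A [d]-maximizer, tested at [s + h] and [s - h], differs from the derivative by at most
   [e / 2 + d / h]; hence the bound [e / 2 * h] on [d]. *)
pose d := Num.min e (e / 2 * h).
have d0 : 0 < d by rewrite lt_min e0 mulr_gt0.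
have de : d <= e by rewrite ge_min lexx.
have dh2 : d <= e / 2 * h by rewrite ge_min lexx orbT.
have : (conjugate Phi s%:E - d%:E < conjugate Phi s%:E)%E.
  by rewrite conjugateE -EFinB lte_fin gtrBl.
move=> /ereal_sup_gt[_ [t /= t0 <-] tP].
have {}tP : (Phi t%:E <= (t * s - psi s + d)%:E)%E.
  move: tP; rewrite conjugateE; case: (Phi t%:E) (entropy_gtNy t0) => [r _| |//].
    by rewrite -!EFinM -!EFinB lte_fin lee_fin => ?; lra.
  by rewrite /= addeNy => _; rewrite ltNge leNye.
have ty y : psi s + t * (y - s) - d <= psi y.
  have := young y t0; move: tP; case: (Phi t%:E) (entropy_gtNy t0) => [r _| _|//].
    by rewrite -EFinD !lee_fin => ? ?; lra.
  by rewrite leye_eq.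
exists t; split => //.
- by rewrite (le_trans tP)// lee_fin lerD2l.
- by move=> y; apply: le_trans (ty y); rewrite lerB.
have hh : `|h| <= h by rewrite gtr0_norm.
have hNh : `|- h| <= h by rewrite normrN gtr0_norm.
have := dh _ hh; have := dh _ hNh; rewrite normrN (gtr0_norm h0) !ler_norml.
move=> /andP[_ u1] /andP[_ u2].
have v1 := ty (s - h); have v2 := ty (s + h).
apply/andP; split; rewrite -(ler_pM2r h0); nra.
Qed.

(** Limit of the affine minorants of [conjugate_approx], whose slopes tend to [Psi' s]. The
    convexity of [Psi] is used below in this form. *)
Lemma conjugate_gradient s y : psi s + dpsi s * (y - s) <= psi y.
Proof.
apply/ler_addgt0Pr => e e0.
(* The minorant costs [e1] and the error on its slope costs [e1 * |y - s|], which add up to [e]. *)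
pose e1 := e / (1 + `|y - s|).
have p0 : 0 < 1 + `|y - s| by rewrite ltr_pwDl.
have e10 : 0 < e1 by rewrite divr_gt0.
have [t [t0 _ /(_ y) ty td]] := conjugate_approx s e10.
have : (dpsi s - t) * (y - s) <= e1 * `|y - s|.
  by rewrite (le_trans (ler_norm _))// normrM ler_wpM2r// distrC.
have : e1 * (1 + `|y - s|) = e by rewrite /e1 divfK// gt_eqF.
by nra.
Qed.

Lemma conjugate'_ge0 s : 0 <= dpsi s.
Proof.
apply/ler_addgt0Pr => e e0.
have [t [t0 _ _ td]] := conjugate_approx s e0.
by move: td; rewrite ler_norml => /andP[]; lra.
Qed.

(** The approximate maximizers converge to [Psi' s]. By lower semi-continuity a strict excess of
    [Phi] at [Psi' s] would persist at them, where [Phi] is known to be small. *)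
Lemma young_eq s : Phi (dpsi s)%:E = (dpsi s * s - psi s)%:E.
Proof.
apply/eqP; rewrite eq_le; apply/andP; split; last first.
  have := young s (conjugate'_ge0 s).
  case: (Phi _) (entropy_gtNy (conjugate'_ge0 s)) => [r _| _|//].
    by rewrite -EFinD !lee_fin; lra.
  by move=> _; rewrite leey.
rewrite leNgt; apply/negP => lP.
(* An intermediate real is needed because [Phi] could a priori be [+oo] here, when [Psi' s] is 0. *)
have [b /andP[b1 b2]] : exists b : R,
    (((dpsi s * s - psi s)%:E < b%:E) && (b%:E < Phi (dpsi s)%:E))%E.
  move: lP; case: (Phi _) (entropy_gtNy (conjugate'_ge0 s)) => [r _| _|//].
    rewrite lte_fin => h; exists ((dpsi s * s - psi s + r) / 2).
    by rewrite !lte_fin midf_lt//= midf_lt.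
  by exists (dpsi s * s - psi s + 1); rewrite ltey lte_fin ltrDl ltr01.
have := @entropy_lsc _ _ hPhi (dpsi s)%:E _ b2.
move=> [V /= VP Vb].
have {}VP : within [set t : \bar R | (0 <= t)%E] (nbhs (dpsi s)%:E) V.
  by rewrite nbhs_subspace_in//= lee_fin conjugate'_ge0.
have {VP} : \forall x \near dpsi s, 0 <= x -> V x%:E.
  have H : \forall x \near (dpsi s)%:E, (0 <= x)%E -> V x by exact: VP.
  rewrite nbhs_EFin in H.
  by near=> x => x0; have := near H x; apply; rewrite ?lee_fin//.
move=> /nbhs_ballP[r /= r0 rV].
rewrite lte_fin in b1.
(* The first bound keeps [t] in the neighborhood where [Phi] exceeds [b]; the second keeps
   [e (1 + |s|)], the total error on [t s - psi s + e], below the gap up to [b]. *)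
pose e := Num.min (r / 2) ((b - (dpsi s * s - psi s)) / (2 * (1 + `|s|))).
have p0 : 0 < 1 + `|s| by rewrite ltr_pwDl.
have e0 : 0 < e by rewrite lt_min !divr_gt0// ?mulr_gt0// subr_gt0.
have er : e <= r / 2 by rewrite ge_min lexx.
have eb : e * (2 * (1 + `|s|)) <= b - (dpsi s * s - psi s).
  by rewrite -ler_pdivlMr ?mulr_gt0// ge_min lexx orbT.
have [t [t0 tP _ td]] := conjugate_approx s e0.
have /Vb : V t%:E.
  apply: rV => //; rewrite /ball/= distrC (le_lt_trans td)// (le_lt_trans er)//.
  by rewrite ltr_pdivrMr// mulr_natr mulr2n ltrDl.
rewrite ltNge (le_trans tP)// lee_fin.
have : (t - dpsi s) * s <= e * `|s|.
  by rewrite (le_trans (ler_norm _))// normrM ler_wpM2r.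
by nra.
Unshelve. all: end_near.
Qed.

Lemma conjugate'_homo x y : x <= y -> dpsi x <= dpsi y.
Proof.
rewrite le_eqVlt => /orP[/eqP ->//|xy].
have := conjugate_gradient x y; have := conjugate_gradient y x.
rewrite -subr_gt0 in xy => u v.
by rewrite -(ler_pM2r xy); nra.
Qed.

Lemma conjugate_homo x y : x <= y -> psi x <= psi y.
Proof.
move=> xy; apply: le_trans (conjugate_gradient x y).
by rewrite lerDl mulr_ge0 ?conjugate'_ge0 ?subr_ge0.
Qed.

Lemma conjugate_ge_id s : s <= psi s.
Proof.
have := young s ler01; rewrite mul1r entropy1// adde0 lee_fin//.
Qed.

Lemma conjugate0 : psi 0 = 0.
Proof.
apply/eqP; rewrite eq_le conjugate_ge_id andbT -lee_fin -conjugateE.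
apply: ge_ereal_sup => _ [t /= t0 <-].
by rewrite mule0 sub0e leeNl oppe0 (entropy_ge0 hPhi)// lee_fin.
Qed.

Lemma conjugate_continuous : continuous psi.
Proof. by move=> s; apply/differentiable_continuous/derivable1_diffP/dPsi. Qed.

(** A differentiable convex function is C1: the gradient inequality at [y], tested at [s + h] and at
    [s - h], squeezes [Psi' y] around [Psi' s]. *)
Lemma conjugate'_continuous : continuous dpsi.
Proof.
move=> s; apply/cvgrPdist_le => /= e e0.
have e20 : 0 < e / 2 by rewrite divr_gt0.
have [h h0 dh] := derive1_approx (@dPsi s) e20.
have hh : `|h| <= h by rewrite gtr0_norm.
have hNh : `|- h| <= h by rewrite normrN gtr0_norm.
have := dh _ hh; have := dh _ hNh; rewrite normrN (gtr0_norm h0) !ler_norml.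
move=> /andP[_ u1] /andP[_ u2].
near=> y.
(* Within [h / 2] of [s], the point [y] stays at distance at least [h / 2] from [s + h] and [s - h],
   so the error [e / 2 * h] is at most [e] times either distance. *)
have yh : `|s - y| <= h / 2.
  near: y; apply: cvgr_dist_le; last by rewrite divr_gt0.
  exact: cvg_id.
rewrite ler_norml in yh; case/andP: yh => y1 y2.
have g1 := conjugate_gradient y (s + h).
have g2 := conjugate_gradient y (s - h).
have g3 := conjugate_gradient s y.
have q1 : 0 < h + (s - y) by lra.
have q2 : 0 < h - (s - y) by lra.
have [sy|sy] := leP s y.
  have := conjugate'_homo sy => sy'.
  have : dpsi y * (h + (s - y)) <= dpsi s * (h + (s - y)) + e / 2 * h by nra.
  have : e / 2 * h <= e * (h + (s - y)) by nra.
  move=> w1 w2; rewrite ler_norml; apply/andP; split; last by lra.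
  by rewrite -(ler_pM2r q1); nra.
have := conjugate'_homo (ltW sy) => sy'.
have : dpsi s * (h - (s - y)) - e / 2 * h <= dpsi y * (h - (s - y)) by nra.
have : e / 2 * h <= e * (h - (s - y)) by nra.
move=> w1 w2; rewrite ler_norml; apply/andP; split; first by lra.
by rewrite -(ler_pM2r q2); nra.
Unshelve. all: end_near.
Qed.

Lemma entropy_fineK t : 0 < t -> Phi t%:E = (fine (Phi t%:E))%:E.
Proof. by move=> t0; rewrite fineK// (entropy_fin_num hPhi). Qed.

(** Slopes all at least [e] would give [Psi s <= e s] for [s < 0], since [Psi 0 = 0], against the
    lower bound [(e / 2) s - Phi (e / 2)] from Young's inequality, where [Phi] is finite. *)
Lemma conjugate'_small e : 0 < e -> exists s, dpsi s < e.
Proof.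
move=> e0; apply: contrapT => /forallNP h.
have {}h s : e <= dpsi s by rewrite leNgt; apply/negP/h.
have e20 : 0 < e / 2 by rewrite divr_gt0.
(* Chosen so that [(e / 2) s] lies strictly below [- Phi (e / 2)]. *)
pose s := - (2 * fine (Phi (e / 2)%:E) / e) - 1.
have := young s (ltW e20); rewrite (entropy_fineK e20) -EFinD lee_fin => y1.
have := conjugate_gradient s 0; rewrite conjugate0 => y2.
have F0 : 0 <= fine (Phi (e / 2)%:E).
  by rewrite fine_ge0// (entropy_ge0 hPhi)// lee_fin ltW.
have s0 : s < 0 by rewrite /s subr_lt0 (@le_lt_trans _ _ 0)// oppr_le0 divr_ge0 ?mulr_ge0 ?(ltW e0).
have hs := h s.
have y3 : psi s <= e * s by nra.
have : e * s = - (2 * fine (Phi (e / 2)%:E)) - e by rewrite /s; field; rewrite gt_eqF.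
by nra.
Qed.

(** Slopes all at most [M] would give [Psi s <= M s] for [s > 0], against the lower bound
    [(M + 1) s - Phi (M + 1)] from Young's inequality. *)
Lemma conjugate'_large M : exists s, M < dpsi s.
Proof.
apply: contrapT => /forallNP h.
have {}h s : dpsi s <= M by rewrite leNgt; apply/negP/h.
have M0 : 0 <= M by rewrite (le_trans (conjugate'_ge0 0)).
have M10 : 0 < M + 1 by rewrite ltr_wpDl.
pose s := fine (Phi (M + 1)%:E) + 1.
have := young s (ltW M10); rewrite (entropy_fineK M10) -EFinD lee_fin => y1.
have := conjugate_gradient s 0; rewrite conjugate0 => y2.
have F0 : 0 <= fine (Phi (M + 1)%:E).
  by rewrite fine_ge0// (entropy_ge0 hPhi)// lee_fin ltW.
have hs := h s.
have s0 : 0 < s by rewrite /s ltr_wpDl.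
have y3 : psi s <= M * s by nra.
by rewrite /s in y1 y3; nra.
Qed.

(** Equality in Young's inequality makes [t] a subgradient of [Psi] at [s], where [Psi] is
    differentiable. This is what identifies the density of an optimal coupling. *)
Lemma young_eq_conjugate' s t : 0 <= t -> (Phi t%:E <= (t * s - psi s)%:E)%E ->
  t = dpsi s.
Proof.
move=> t0 tP; apply/esym/subgradient_derive1; first exact: dPsi.
near=> x; have := young x t0; move: tP.
case: (Phi t%:E) (entropy_gtNy t0) => [r _| _|//].
  by rewrite -EFinD !lee_fin; lra.
by rewrite leye_eq.
Unshelve. all: end_near.
Qed.

(** Read from the other side, equality in Young's inequality makes [x] a subgradient of [Phi] at
    [Psi' x], and [Phi] is differentiable there as soon as [Psi' x > 0]. *)
Lemma conjugate'_inj x y : 0 < dpsi x -> dpsi x = dpsi y -> x = y.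
Proof.
move=> x0 xy; have H z : dpsi z = dpsi x ->
    derive1 (fun r : R => fine (Phi r%:E)) (dpsi x) = z.
  move=> zx; apply: subgradient_derive1; first exact: (entropy_derivable hPhi).
  have : \forall t \near dpsi x, 0 < t by exact: lt_nbhsr.
  apply: filterS => t t0; have := young z (ltW t0).
  rewrite (entropy_fineK t0) -EFinD lee_fin.
  by have := young_eq z; rewrite zx => ->; rewrite /=; lra.
by rewrite -(H x)// (H y).
Qed.

End conjugate_theory.

(** * Measurability and image measures *)

Section measurability.
Context {R : realType}.
Local Open Scope ereal_scope.

Lemma emeasurable_fun_EFin (f : \bar R -> \bar R) :
  measurable_fun [set: R] (f \o EFin) -> measurable_fun [set: \bar R] f.
Proof.
move=> mf _ Y mY; rewrite setTI.
have -> : f @^-1` Y = EFin @` ((f \o EFin) @^-1` Y) `|`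
    ([set +oo] `&` (f @^-1` Y)) `|` ([set -oo] `&` (f @^-1` Y)).
  apply/seteqP; split=> [[r|//|//] /= fY|x [[[r /= fY <-//]|[//]]|[//]]].
  - by left; left; exists r.
  - by left; right.
  - by right.
have m1 (x : \bar R) : measurable ([set x] `&` f @^-1` Y).
  have [xY|xY] := pselect (Y (f x)).
    rewrite (_ : _ `&` _ = [set x]); first exact: emeasurable_set1.
    by apply/seteqP; split=> [y []//|y /= ->].
  rewrite (_ : _ `&` _ = set0); first exact: measurable0.
  by apply/seteqP; split=> [y [/= ->]//|y//].
apply: measurableU => //; apply: measurableU => //.
by apply: measurable_image_EFin; have := mf measurableT _ mY; rewrite setTI.
Qed.

Variable Phi : \bar R -> \bar R.
Hypothesis hPhi : is_entropy Phi.

(** [Phi] is controlled at nonnegative arguments only; precomposed with the absolute value it is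
    lower semi-continuous on the whole line. *)
Lemma measurable_entropy d (T : measurableType d) (f : T -> R) :
  measurable_fun setT f -> (forall x, (0 <= f x)%R) ->
  measurable_fun setT (fun x => Phi (f x)%:E).
Proof.
move=> mf f0; pose g (t : R) := Phi `|t|%:E.
rewrite (_ : (fun x => _) = g \o f); last first.
  by apply/funext => x; rewrite /g /= ger0_norm.
suff lg : lower_semicontinuous g.
  by apply: measurableT_comp mf; exact: lower_semicontinuous_measurable lg.
move=> x a ax; have := @entropy_lsc _ _ hPhi `|x|%:E _ ax.
move=> [V /= VP Vb].
have {}VP : within [set t : \bar R | (0 <= t)%E] (nbhs `|x|%:E) V.
  by rewrite nbhs_subspace_in//= lee_fin.
exists [set t : R | V `|t|%:E]; last by move=> y /= /Vb.
have H : \forall y \near `|x|%:E, (0 <= y)%E -> V y by exact: VP.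
rewrite nbhs_EFin in H.
have H2 : \forall y \near x, (0 <= `|y|%:E)%E -> V `|y|%:E.
  exact: (@norm_continuous _ _ x _ H).
by apply: filterS H2 => y; apply; rewrite lee_fin.
Qed.

Hypothesis dPsi :
  forall s : R, derivable (fun r : R => fine (conjugate Phi r%:E)) s 1.

Lemma measurable_conjugate : measurable_fun setT (conjugate Phi).
Proof.
apply: emeasurable_fun_EFin; rewrite (_ : _ \o _ = EFin \o (fun r => fine (conjugate Phi r%:E))).
  apply/measurable_EFinP; apply: continuous_measurable_fun.
  exact: conjugate_continuous.
by apply/funext => r /=; rewrite fineK// conjugate_fin_num.
Qed.

Lemma measurable_conjugate' : measurable_fun setT (conjugate' Phi).
Proof.
apply: emeasurable_fun_EFin.
rewrite (_ : _ \o _ = EFin \o derive1 (fun r : R => fine (conjugate Phi r%:E)))//.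
apply/measurable_EFinP; apply: continuous_measurable_fun.
exact: conjugate'_continuous.
Qed.

Lemma conjugate'e_ge0 x : 0 <= conjugate' Phi x.
Proof. by case: x => [r| |] //=; rewrite lee_fin conjugate'_ge0. Qed.

End measurability.

Section image_measure.
Context d d' (S : measurableType d) (T : measurableType d') {R : realType}.
Variables (mu : {measure set S -> \bar R}) (nu : {measure set T -> \bar R}).
Variable phi : S -> T.
Hypothesis mphi : measurable_fun setT phi.
Hypothesis muphi : forall A, measurable A -> mu (phi @^-1` A) = nu A.
Local Open Scope ereal_scope.

Lemma image_measure_ae (P : T -> Prop) :
  {ae nu, forall t, P t} -> {ae mu, forall s, P (phi s)}.
Proof.
move=> [N [mN N0 PN]]; exists (phi @^-1` N); split.
- by have := mphi measurableT mN; rewrite setTI.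
- by rewrite muphi.
- by move=> s /= /PN.
Qed.

Lemma image_measure_ge0_integral (f : T -> \bar R) :
  measurable_fun setT f -> (forall t, 0 <= f t) ->
  \int[mu]_s f (phi s) = \int[nu]_t f t.
Proof.
move=> mf f0.
rewrite -[LHS](@ge0_integral_pushforward _ _ _ _ _ _ mphi mu setT f)//.
by apply: eq_measure_integral => A mA _; rewrite /= /pushforward muphi.
Qed.

Lemma image_measure_integrable (f : T -> \bar R) :
  nu.-integrable setT f -> mu.-integrable setT (f \o phi).
Proof.
move=> /integrableP[mf fi]; apply/integrableP; split.
  exact: measurableT_comp.
rewrite /= (image_measure_ge0_integral (f := fun t => `|f t|))//.
exact: measurableT_comp.
Qed.

Lemma image_measure_integral (f : T -> \bar R) :
  nu.-integrable setT f -> \int[mu]_s f (phi s) = \int[nu]_t f t.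
Proof.
move=> fi; have mf := measurable_int _ fi.
rewrite -[LHS](@integral_pushforward _ _ _ _ _ phi mphi mu setT f)//.
  by apply: eq_measure_integral => A mA _; rewrite /= /pushforward muphi.
exact: image_measure_integrable.
Qed.

End image_measure.

Section density_measure.
Context d (T : measurableType d) {R : realType} (mu : {measure set T -> \bar R}).
Local Open Scope ereal_scope.

(** The two proofs are arguments of the definition so that the measure structure declared below can
    be inferred from the term alone. *)
Definition density_measure (f : T -> \bar R) of
    measurable_fun setT f & (forall x, 0 <= f x) :=
  fun A => \int[mu]_(x in A) f x.

Variables (f : T -> \bar R) (mf : measurable_fun setT f) (f0 : forall x, 0 <= f x).

Local Notation m := (density_measure mf f0).

Let m0 : m set0 = 0. Proof. exact: integral_set0. Qed.

Let m_ge0 A : 0 <= m A. Proof. by apply: integral_ge0 => x _; exact: f0. Qed.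

Let m_sigma : semi_sigma_additive m.
Proof. exact: semi_sigma_additive_nng_induced. Qed.

HB.instance Definition _ := isMeasure.Build _ _ _ m m0 m_ge0 m_sigma.

(** The total mass is known only through a hypothesis, so the probability structure is packed inside
    the proof and only an existence statement is exported. *)
Lemma density_probability : \int[mu]_x f x = 1 ->
  exists g : probability T R,
    forall A, measurable A -> g A = \int[mu]_(x in A) f x.
Proof.
move=> f1; pose P := Measure_isProbability.Build _ _ _ m f1.
by exists (HB.pack_for (probability T R) (density_measure mf f0) P).
Qed.

End density_measure.

Section coordinates.
Context {R : realType} {n : nat} {d : 'I_n -> measure_display}.
Variables (T : forall i, measurableType (d i)) (P : forall i, probability (T i) R).
Local Open Scope ereal_scope.

Lemma measurable_cylinder i (A : set (T i)) : measurable A ->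
  measurable ([set x | A (x i)] : set (prod_space T)).
Proof. by move=> mA; apply: sub_sigma_algebra; exists i, A. Qed.

Lemma product_prob_coord i (A : set (T i)) : measurable A ->
  product_prob P [set x | A (x i)] = P i A.
Proof.
move=> mA; pose B := dfwith (fun j => [set: T j]) i A.
have mB j : measurable (B j) by rewrite /B; case: dfwithP.
have -> : [set x : prod_space T | A (x i)] = [set x : prod_space T | forall j, B j (x j)].
  apply/seteqP; split=> x /= => [Ax j|/(_ i)]; last by rewrite /B dfwithin.
  by rewrite /B; case: dfwithP.
rewrite product_probE// (bigD1 i)//= /B dfwithin big1 ?mule1// => j ji.
by rewrite dfwithout 1?eq_sym// probability_setT.
Qed.

End coordinates.

(** * Integrability *)

Section almost_everywhere.
Context d (T : measurableType d) {R : realType}.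
Variable mu : {measure set T -> \bar R}.
Implicit Types P Q : T -> Prop.

Lemma ae_impl P Q : {ae mu, forall x, P x} -> (forall x, P x -> Q x) ->
  {ae mu, forall x, Q x}.
Proof. by move=> Px PQ; apply: filterS Px. Qed.

Lemma ae_and P Q : {ae mu, forall x, P x} -> {ae mu, forall x, Q x} ->
  {ae mu, forall x, P x /\ Q x}.
Proof. exact: filterI. Qed.

Lemma ae_forall_fin (I : finType) (P : I -> T -> Prop) :
  (forall i, {ae mu, forall x, P i x}) -> {ae mu, forall x i, P i x}.
Proof. by move=> Px; apply: filter_forall. Qed.

End almost_everywhere.

Lemma cvg_EFin_comp {R : realType} (h : R -> R) (f : nat -> R) (a : R) :
  continuous h -> f n @[n --> \oo] --> a ->
  (h (f n))%:E @[n --> \oo] --> (h a)%:E.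
Proof.
move=> ch fa; apply/fine_cvgP; split; first exact: nearW.
exact: (cvg_comp f h fa (ch a)).
Qed.

Section integrability.
Context d (T : measurableType d) {R : realType} (mu : {measure set T -> \bar R}).
Local Open Scope ereal_scope.
Implicit Types f h : T -> \bar R.

Lemma integrable_between h1 h2 f : measurable_fun setT f ->
  mu.-integrable setT h1 -> mu.-integrable setT h2 ->
  (forall x, h1 x <= f x) -> (forall x, f x <= h2 x) -> mu.-integrable setT f.
Proof.
move=> mf i1 i2 h1f fh2.
have iD : mu.-integrable setT (fun x => `|h1 x| + `|h2 x|).
  by apply: integrableD => //; exact: integrable_abse.
apply: le_integrable iD => // x _; rewrite (@gee0_abs _ (_ + _)) ?adde_ge0//.
have [fx|fx] := leP 0 (f x).
  by rewrite gee0_abs// (le_trans (fh2 x))// (le_trans (lee_abs _))// leeDr.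
rewrite lte0_abs// (@le_trans _ _ (- h1 x)) ?leeN2//.
by rewrite (le_trans (lee_abs _))// abseN leeDl.
Qed.

(** By convention [+oo - +oo] is [-oo], so a bound [< +oo] on the integral says nothing by itself:
    the minorant [h] first makes the negative part integrable. *)
Lemma integrable_ge h f : measurable_fun setT f -> mu.-integrable setT h ->
  (forall x, h x <= f x) -> \int[mu]_x f x < +oo -> mu.-integrable setT f.
Proof.
move=> mf ih hf.
have iN : mu.-integrable setT f^\-.
  apply: le_integrable (integrable_funeneg measurableT ih) => //.
    exact: measurable_funeneg.
  move=> x _; rewrite !gee0_abs//; rewrite !funenegE.
  by rewrite ge_max !le_max lexx orbT andbT leeN2 hf.
rewrite integralE => fy.
have iP : mu.-integrable setT f^\+.
  apply/integrableP; split; first exact: measurable_funepos.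
  under eq_integral => x _ do rewrite gee0_abs//.
  move: fy; have := integrable_fin_num measurableT iN.
  case: (\int[mu]_x f^\- x) => [r _| |]//.
  by case: (\int[mu]_x f^\+ x) => [s _| |_]; rewrite ?ltry ?addye ?ltxx.
rewrite (funeposneg f); exact: integrableB.
Qed.

Lemma integrable_le h f : measurable_fun setT f -> mu.-integrable setT h ->
  (forall x, f x <= h x) -> -oo < \int[mu]_x f x -> mu.-integrable setT f.
Proof.
move=> mf ih fh fy.
have iP : mu.-integrable setT f^\+.
  apply: le_integrable (integrable_funepos measurableT ih) => //.
    exact: measurable_funepos.
  move=> x _; rewrite !gee0_abs//; rewrite !funeposE.
  by rewrite ge_max !le_max lexx orbT andbT fh.
move: fy; rewrite integralE => fy.
have iN : mu.-integrable setT f^\-.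
  apply/integrableP; split; first exact: measurable_funeneg.
  under eq_integral => x _ do rewrite gee0_abs//.
  rewrite ltey; apply: contraTN fy => /eqP ->.
  by rewrite addeNy ltxx.
rewrite (funeposneg f); exact: integrableB.
Qed.

(** Meant for the entropy term, whose integral may be infinite: if [f] is not integrable, neither is
    [f + h], and both sides are [+oo]. *)
Lemma ge0_integralD_integrable f (h : T -> R) : measurable_fun setT f ->
  (forall x, 0 <= f x) -> mu.-integrable setT (EFin \o h) ->
  \int[mu]_x (f x + (h x)%:E) = \int[mu]_x f x + \int[mu]_x (h x)%:E.
Proof.
move=> mf f0 ih; have [fi|nf] := pselect (mu.-integrable setT f).
  exact: (integralD measurableT fi ih).
have mfh : measurable_fun setT (fun x => f x + (h x)%:E).
  by apply: emeasurable_funD => //; exact: measurable_int ih.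
have -> : \int[mu]_x f x = +oo.
  apply/eqP; rewrite -leye_eq leNgt; apply/negP => fy; apply: nf.
  apply/integrableP; split => //.
  by under eq_integral => x _ do rewrite gee0_abs//.
rewrite addye; last first.
  by have := integrable_fin_num measurableT ih; rewrite fin_numE => /andP[].
apply/eqP; rewrite -leye_eq leNgt; apply/negP => fy; apply: nf.
have ifh : mu.-integrable setT (fun x => f x + (h x)%:E).
  by apply: integrable_ge ih _ fy => // x /=; rewrite leeDr.
have := integrableB measurableT ifh ih; congr (_.-integrable _ _).
by apply/funext => x /=; rewrite addeK.
Qed.

Lemma fin_num_integrable f : measurable_fun setT f ->
  \int[mu]_x f x \is a fin_num -> mu.-integrable setT f.
Proof.
move=> mf; rewrite integralE => fi.
have : 0 <= \int[mu]_x f^\- x by exact: integral_ge0.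
have : 0 <= \int[mu]_x f^\+ x by exact: integral_ge0.
move=> p0 n0; have [py ny] : \int[mu]_x f^\+ x < +oo /\ \int[mu]_x f^\- x < +oo.
  move: fi p0 n0; case: (\int[mu]_x f^\+ x) => [p| |]//.
    by case: (\int[mu]_x f^\- x) => [q| |]// _ _ _; split; exact: ltry.
  by case: (\int[mu]_x f^\- x).
rewrite (funeposneg f); apply: integrableB => //; apply/integrableP; split.
- exact: measurable_funepos.
- by under eq_integral => x _ do rewrite gee0_abs//.
- exact: measurable_funeneg.
- by under eq_integral => x _ do rewrite gee0_abs//.
Qed.

Lemma ae_integrable f h : measurable_fun setT h ->
  {ae mu, forall x, f x = h x} -> mu.-integrable setT f -> mu.-integrable setT h.
Proof.
move=> mh fh /integrableP[mf fi]; apply/integrableP; split => //.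
suff -> : \int[mu]_x `|h x| = \int[mu]_x `|f x| by [].
apply: ae_eq_integral => //.
- exact: measurableT_comp.
- exact: measurableT_comp.
- by apply: (ae_impl fh) => x ->.
Qed.

End integrability.

Section change_of_variables.
Context d (T : measurableType d) {R : realType}.
Variables (nu : {finite_measure set T -> \bar R}).
Variables (mu : {sigma_finite_measure set T -> \bar R}).
Hypothesis numu : nu `<< mu.
Variable h : T -> \bar R.
Hypothesis ih : nu.-integrable setT h.
Local Open Scope ereal_scope.
Local Notation f := (Radon_Nikodym_SigmaFinite.f nu mu).

Let f_fin x : f x \is a fin_num.
Proof. exact: Radon_Nikodym_SigmaFinite.f_fin_num. Qed.

Let funeposnegM : (fun x => h x * f x) =
  (fun x => h^\+ x * f x) \- (fun x => h^\- x * f x).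
Proof.
apply/funext => x /=; rewrite -muleBl//; last exact: add_def_funeposneg.
by rewrite {1}(funeposneg h).
Qed.

Let ip : mu.-integrable setT (fun x => h^\+ x * f x).
Proof.
by apply: Radon_Nikodym_SigmaFinite.integrableM => //; exact: integrable_funepos.
Qed.

Let im : mu.-integrable setT (fun x => h^\- x * f x).
Proof.
by apply: Radon_Nikodym_SigmaFinite.integrableM => //; exact: integrable_funeneg.
Qed.

Lemma integrable_Radon_Nikodym : mu.-integrable setT (fun x => h x * f x).
Proof. by rewrite funeposnegM; exact: integrableB. Qed.

(** [h] will be the slack, which has no sign, so the formula for nonnegative functions is applied to
    its positive and negative parts. *)
Lemma integral_Radon_Nikodym : \int[mu]_x (h x * f x) = \int[nu]_x h x.
Proof.
have mh := measurable_int _ ih.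
rewrite funeposnegM integralB// [RHS]integralE.
congr (_ - _); apply: Radon_Nikodym_SigmaFinite.change_of_variables => //.
  exact: measurable_funepos.
exact: measurable_funeneg.
Qed.

End change_of_variables.

(** * Finite potentials and the duality gap *)

Definition emb {R : realType} {N : nat} {X : 'I_N -> completeMetricType R}
    (w : forall i, X i -> R) : forall i, X i -> \bar R :=
  fun i x => (w i x)%:E.
Arguments emb {R N X} w i x.

Section real_potentials.
Context {R : realType} {N : nat} {X : 'I_N -> completeMetricType R}.
Variables (c : (forall i, X i) -> R) (eps : R) (Phi : \bar R -> \bar R).
Variable rho : forall i, probability (borel (X i)) R.
Local Open Scope ereal_scope.

Local Notation XN := (prod_space (fun i => borel (X i))).
Local Notation rhoN := (product_prob rho).
Local Notation psi := (fun r : R => fine (conjugate Phi r%:E)).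
Local Notation dpsi := (derive1 psi).

Implicit Types (u v : forall i, X i -> \bar R) (w : forall i, X i -> R).
Implicit Type g : probability XN R.

Definition rslack w (x : forall i, X i) : R :=
  ((\sum_(i < N) w i (x i) - c x) / eps)%R.

Hypothesis eps0 : (0 < eps)%R.
Hypothesis mc : measurable_fun [set: XN] c.
Variable M : R.
Hypothesis cM : forall x, (`|c x| <= M)%R.
Hypothesis hPhi : is_entropy Phi.
Hypothesis dPsi :
  forall s : R, derivable (fun r : R => fine (conjugate Phi r%:E)) s 1.

Lemma slack_emb w x : slack c eps (emb w) x = (rslack w x)%:E.
Proof. by rewrite /slack /emb sumEFin -EFinB -EFinM. Qed.

Lemma measurable_rslack w :
  (forall i, measurable_fun [set: borel (X i)] (w i)) ->
  measurable_fun [set: XN] (rslack w).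
Proof.
move=> mw; apply: measurable_funM => //; apply: measurable_funB => //.
apply: measurable_sum => i.
exact: (measurableT_comp (mw i) (measurable_coord i)).
Qed.

Lemma measurable_slack u :
  (forall i, measurable_fun [set: borel (X i)] (u i)) ->
  measurable_fun [set: XN] (slack c eps u).
Proof.
move=> mu; rewrite /slack.
apply: emeasurable_funM; last exact: measurable_cst.
apply: emeasurable_funB; last exact/measurable_EFinP.
apply: emeasurable_sum => i.
exact: (measurableT_comp (mu i) (measurable_coord i)).
Qed.

Lemma coord_ae i (P : X i -> Prop) :
  {ae rho i, forall x, P x} -> {ae rhoN, forall x, P (x i)}.
Proof.
apply: (@image_measure_ae _ _ _ _ _ rhoN (rho i) (fun x => x i)).
  exact: measurable_coord.
exact: product_prob_coord.
Qed.

Lemma slack_ae u v : (forall i, {ae rho i, forall x, u i x = v i x}) ->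
  {ae rhoN, forall x, slack c eps u x = slack c eps v x}.
Proof.
move=> uv.
have := @ae_forall_fin _ _ _ rhoN _ _ (fun i => coord_ae (uv i)).
move=> /ae_impl; apply => x h; rewrite /slack; congr (_ * _); congr (_ - _).
by apply: eq_bigr => i _.
Qed.

Lemma dual_ae u v :
  (forall i, measurable_fun [set: borel (X i)] (u i)) ->
  (forall i, measurable_fun [set: borel (X i)] (v i)) ->
  (forall i, {ae rho i, forall x, u i x = v i x}) ->
  dual c eps Phi rho u = dual c eps Phi rho v.
Proof.
move=> mu mv uv; rewrite /dual; congr (_ - _ * _).
  apply: eq_bigr => i _; apply: ae_eq_integral => //.
  by apply: (ae_impl (uv i)) => x ->.
have mP := measurable_conjugate hPhi dPsi.
apply: ae_eq_integral => //.
- exact: (measurableT_comp mP (measurable_slack mu)).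
- exact: (measurableT_comp mP (measurable_slack mv)).
- by apply: (ae_impl (slack_ae uv)) => x ->.
Qed.

Lemma measurable_density u :
  (forall i, measurable_fun [set: borel (X i)] (u i)) ->
  measurable_fun [set: XN] (conjugate' Phi \o slack c eps u).
Proof.
move=> mu; apply: measurableT_comp; last exact: measurable_slack.
exact: measurable_conjugate'.
Qed.

Lemma gamma_star_ae u v g :
  (forall i, measurable_fun [set: borel (X i)] (u i)) ->
  (forall i, measurable_fun [set: borel (X i)] (v i)) ->
  (forall i, {ae rho i, forall x, u i x = v i x}) ->
  is_gamma_star c eps Phi rho u g -> is_gamma_star c eps Phi rho v g.
Proof.
move=> mu mv uv gu A mA; rewrite gu//; apply: ae_eq_integral => //.
- exact: measurable_funTS (measurable_density mu).
- exact: measurable_funTS (measurable_density mv).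
- by apply: (ae_impl (slack_ae uv)) => x -> _.
Qed.

Lemma coupling_integrable g i (f : X i -> \bar R) : couplings rho g ->
  (rho i).-integrable setT (f : borel (X i) -> \bar R) ->
  g.-integrable setT (fun x : XN => f (x i)).
Proof.
move=> cg; apply: (@image_measure_integrable _ _ _ _ _ g (rho i) (fun x => x i)).
  exact: measurable_coord.
exact: cg.
Qed.

Lemma coupling_integral g i (f : X i -> \bar R) : couplings rho g ->
  (rho i).-integrable setT (f : borel (X i) -> \bar R) ->
  \int[g]_x f (x i) = \int[rho i]_x f x.
Proof.
move=> cg; apply: (@image_measure_integral _ _ _ _ _ g (rho i) (fun x => x i)).
  exact: measurable_coord.
exact: cg.
Qed.

Lemma product_coupling : couplings rho rhoN.
Proof. by move=> i A mA; exact: product_prob_coord. Qed.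

Lemma cost_integrable g : g.-integrable setT (EFin \o (c : XN -> R)).
Proof.
apply: measurable_bounded_integrable => //.
  by rewrite (le_lt_trans (@probability_le1 _ _ _ g _ _))// ltry.
exists M; split; first exact: num_real.
by move=> y My x _; exact: le_trans (cM x) (ltW My).
Qed.

Section integrable_potentials.
Unset Implicit Arguments.
Variable w : forall i, X i -> R.
Set Implicit Arguments.
Hypothesis mw : forall i, measurable_fun [set: borel (X i)] (w i).
Hypothesis iw : forall i, (rho i).-integrable setT (EFin \o (w i : borel (X i) -> R)).

Lemma rslack_integrable g : couplings rho g ->
  g.-integrable setT (EFin \o (rslack w : XN -> R)).
Proof.
move=> cg.
have : g.-integrable setT (fun x : XN =>
    (eps^-1)%:E * (\sum_(i < N) (w i (x i))%:E - (c x)%:E)).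
  apply: integrableZl => //; apply: integrableB => //; last exact: cost_integrable.
  by apply: integrable_sum => // i _; exact: (coupling_integrable cg (iw i)).
congr (_.-integrable _ _); apply/funext => x.
by rewrite /rslack /= sumEFin -EFinB -EFinM mulrC.
Qed.

(** Each potential depends on one coordinate and sees only the marginal of [g], so the cost is the
    only term that varies with the coupling. *)
Lemma rslack_integral g : couplings rho g ->
  \int[g]_x (rslack w x)%:E =
  (eps^-1)%:E * (\sum_(i < N) \int[rho i]_x (w i x)%:E - \int[g]_x (c x)%:E).
Proof.
move=> cg.
have iS : g.-integrable setT (fun x : XN => \sum_(i < N) (w i (x i))%:E).
  by apply: integrable_sum => // i _; exact: (coupling_integrable cg (iw i)).
transitivity (\int[g]_x ((eps^-1)%:E * (\sum_(i < N) (w i (x i))%:E - (c x)%:E))).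
  by apply: eq_integral => x _; rewrite /rslack sumEFin -EFinB -EFinM mulrC.
rewrite integralZl//; last by apply: integrableB => //; exact: cost_integrable.
rewrite integralB//; last exact: cost_integrable.
congr (_ * (_ - _)); rewrite integral_sum//; last first.
  by move=> i; exact: (coupling_integrable cg (iw i)).
by apply: eq_bigr => i _; exact: (coupling_integral cg (iw i)).
Qed.

Lemma dual_emb : dual c eps Phi rho (emb w) =
  \sum_(i < N) \int[rho i]_x (w i x)%:E - eps%:E * \int[rhoN]_x (psi (rslack w x))%:E.
Proof.
rewrite /dual; congr (_ - _ * _); apply: eq_integral => x _.
by rewrite slack_emb fineK// conjugate_fin_num.
Qed.

Lemma measurable_psi_rslack : measurable_fun [set: XN] (EFin \o (psi \o rslack w)).
Proof.
apply/measurable_EFinP; apply: measurableT_comp; last exact: measurable_rslack.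
by apply: continuous_measurable_fun; exact: conjugate_continuous.
Qed.

Lemma measurable_dpsi_rslack : measurable_fun [set: XN] (dpsi \o rslack w).
Proof.
apply: measurableT_comp; last exact: measurable_rslack.
by apply: continuous_measurable_fun; exact: conjugate'_continuous.
Qed.

(** A dual value above [-oo] excludes the integral [+oo], and [Psi s >= s] provides the integrable
    minorant. *)
Lemma psi_integrable : -oo < dual c eps Phi rho (emb w) ->
  rhoN.-integrable setT (EFin \o (psi \o rslack w)).
Proof.
rewrite dual_emb => d0.
apply: (integrable_ge _ (rslack_integrable product_coupling)).
- exact: measurable_psi_rslack.
- by move=> x /=; rewrite lee_fin conjugate_ge_id.
rewrite ltey; apply: contraTN d0 => /eqP ->.
by rewrite gt0_muley ?lte_fin// addeNy ltxx.
Qed.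

Lemma dual_emb_fin_num :
  rhoN.-integrable setT (EFin \o (psi \o rslack w)) ->
  dual c eps Phi rho (emb w) \is a fin_num.
Proof.
move=> ip; rewrite dual_emb fin_numB fin_numM ?andbT//; last exact: integrable_fin_num.
by rewrite sum_fin_num; apply/allP => _ /mapP[i _ ->]; exact: integrable_fin_num (iw i).
Qed.

Hypothesis ip : rhoN.-integrable setT (EFin \o (psi \o rslack w)).

Local Notation RN g := (Radon_Nikodym_SigmaFinite.f g rhoN).

(** Only the entropy term is left in the extended reals; the rest is a real number, so the sum is
    never of the form [+oo - +oo]. *)
Let gap g x : \bar R :=
  Phi (RN g x) + (psi (rslack w x) - fine (RN g x) * rslack w x)%:E.

Lemma gap_ge0 g x : g `<< rhoN -> 0 <= gap g x.
Proof.
move=> gr; have f0 := Radon_Nikodym_SigmaFinite.f_ge0 gr x.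
have := Radon_Nikodym_SigmaFinite.f_fin_num gr x.
rewrite /gap; case: (RN g x) f0 => [t|//|//]; rewrite lee_fin => t0 _ /=.
have := young hPhi (rslack w x) t0.
case: (Phi t%:E) (entropy_gtNy hPhi t0) => [r _| _ _|//].
  by rewrite -!EFinD !lee_fin; lra.
by rewrite addye.
Qed.

Lemma measurable_RN g : g `<< rhoN -> measurable_fun [set: XN] (fine \o RN g).
Proof.
move=> gr; apply: measurableT_comp => //.
exact: measurable_int (Radon_Nikodym_SigmaFinite.f_integrable gr).
Qed.

Lemma RN_fineK g x : g `<< rhoN -> (fine (RN g x))%:E = RN g x.
Proof. by move=> gr; rewrite fineK//; exact: Radon_Nikodym_SigmaFinite.f_fin_num. Qed.

Lemma RN_fine_ge0 g x : g `<< rhoN -> (0 <= fine (RN g x))%R.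
Proof. by move=> gr; apply: fine_ge0; exact: Radon_Nikodym_SigmaFinite.f_ge0. Qed.

Lemma measurable_Phi_RN g : g `<< rhoN -> measurable_fun [set: XN] (Phi \o RN g).
Proof.
move=> gr; have := measurable_entropy hPhi (measurable_RN gr)
  (fun x => RN_fine_ge0 x gr).
by congr measurable_fun; apply/funext => x /=; rewrite RN_fineK.
Qed.

Lemma measurable_gap g : g `<< rhoN -> measurable_fun [set: XN] (gap g).
Proof.
move=> gr; apply: emeasurable_funD; first exact: measurable_Phi_RN.
apply/measurable_EFinP; apply: measurable_funB.
  by apply/measurable_EFinP; exact: measurable_psi_rslack.
by apply: measurable_funM; [exact: measurable_RN|exact: measurable_rslack].
Qed.

Lemma duality_gap g : couplings rho g -> g `<< rhoN ->
  primal c eps Phi rho g =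
  dual c eps Phi rho (emb w) + eps%:E * \int[rhoN]_x gap g x.
Proof.
move=> cg gr.
have irs := rslack_integrable cg.
have fsE : (fun x => (rslack w x)%:E * RN g x) =
    EFin \o (fun x => fine (RN g x) * rslack w x)%R.
  by apply/funext => x /=; rewrite -(RN_fineK x gr) -EFinM mulrC.
have ifs := integrable_Radon_Nikodym gr irs; rewrite fsE in ifs.
have int_fs := integral_Radon_Nikodym gr irs; rewrite fsE in int_fs.
rewrite /primal /divergence asboolT// /gap ge0_integralD_integrable; last 3 first.
- exact: measurable_Phi_RN.
- move=> x; apply: (entropy_ge0 hPhi).
  exact: Radon_Nikodym_SigmaFinite.f_ge0.
- rewrite (_ : _ \o _ = (EFin \o (psi \o rslack w)) \-
      (EFin \o (fun x => fine (RN g x) * rslack w x)%R))//.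
  exact: integrableB.
under [X in _ = _ + _ * (_ + X)]eq_integral => x _ do rewrite EFinB.
rewrite integralB// int_fs rslack_integral// dual_emb.
(* All terms except the integral of [Phi] are finite and are replaced by reals: either that integral
   is finite and the identity is algebraic, or both sides are [+oo]. *)
have : \sum_(i < N) \int[rho i]_x (w i x)%:E \is a fin_num.
  by rewrite sum_fin_num; apply/allP => _ /mapP[i _ ->]; exact: integrable_fin_num (iw i).
move: (\sum_(i < N) _) => a /fineK <-.
have := integrable_fin_num measurableT ip.
rewrite /=; move: (\int[rhoN]_x (psi (rslack w x))%:E) => b /fineK <-.
have := integrable_fin_num measurableT (cost_integrable g).
rewrite /=; move: (\int[g]_x (c x)%:E) => k /fineK <-.
have : 0 <= \int[rhoN]_x Phi (RN g x).
  apply: integral_ge0 => x _; apply: (entropy_ge0 hPhi).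
  exact: Radon_Nikodym_SigmaFinite.f_ge0.
case: (\int[rhoN]_x Phi (RN g x)) => [p _| _|//].
  do ?[rewrite -EFinM|rewrite -EFinB|rewrite -EFinD]; congr EFin.
  by field; rewrite gt_eqF.
do ?[rewrite -EFinM|rewrite -EFinB].
by rewrite addye// gt0_muley ?lte_fin// !addey.
Qed.

Lemma weak_duality g : couplings rho g ->
  dual c eps Phi rho (emb w) <= primal c eps Phi rho g.
Proof.
move=> cg; have [gr|gr] := pselect (g `<< rhoN).
  rewrite duality_gap// leeDl// mule_ge0 ?lee_fin ?(ltW eps0)//.
  by apply: integral_ge0 => x _; exact: gap_ge0.
rewrite /primal /divergence asboolF// gt0_muley ?lte_fin// addey ?leey//.
by have := integrable_fin_num measurableT (cost_integrable g); rewrite fin_numE => /andP[].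
Qed.

Lemma optimal_gamma_star g : couplings rho g ->
  primal c eps Phi rho g = dual c eps Phi rho (emb w) ->
  is_gamma_star c eps Phi rho (emb w) g.
Proof.
move=> cg gd; have d_fin := dual_emb_fin_num ip.
have gr : g `<< rhoN.
  apply: contrapT => gr; move: gd d_fin => <-.
  rewrite /primal /divergence asboolF// gt0_muley ?lte_fin// addey//.
  by have := integrable_fin_num measurableT (cost_integrable g); rewrite fin_numE => /andP[].
have mf := measurable_int _ (Radon_Nikodym_SigmaFinite.f_integrable gr).
(* The common value is finite and can be cancelled, which leaves [eps] times the integral of the gap
   equal to 0. *)
have : \int[rhoN]_x gap g x = 0.
  move: gd d_fin; rewrite duality_gap//; case: (dual _ _ _ _ _) => [r| |]//.
  have : 0 <= \int[rhoN]_x gap g x by apply: integral_ge0 => x _; exact: gap_ge0.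
  case: (\int[rhoN]_x gap g x) => [p _ + _ | _ + _ | //].
    rewrite -EFinM -EFinD => -[] /eqP; rewrite -subr_eq0 addrAC subrr add0r mulf_eq0.
    by rewrite (gt_eqF eps0) => /eqP ->.
  by rewrite gt0_muley ?lte_fin// addey.
rewrite (eq_integral (fun x => `|gap g x|)); last first.
  by move=> x _; rewrite gee0_abs// gap_ge0.
move=> /(ae_eq_integral_abs rhoN measurableT (measurable_gap gr)) gap0.
move=> A mA; rewrite (Radon_Nikodym_SigmaFinite.f_integral gr)//.
apply: ae_eq_integral => //.
- exact: measurable_funTS.
- apply: measurable_funTS; apply: measurable_density => i.
  exact/measurable_EFinP.
apply: (ae_impl gap0) => x /(_ I) /= gx _.
rewrite slack_emb -(RN_fineK x gr) /=; congr EFin.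
apply: (young_eq_conjugate' hPhi dPsi); first exact: RN_fine_ge0.
move: gx; rewrite /gap -(RN_fineK x gr) /=.
case: (Phi _) (entropy_gtNy hPhi (RN_fine_ge0 x gr)) => [r _| _|//].
  by rewrite -EFinD lee_fin => -[]; lra.
by rewrite addye.
Qed.

Lemma gamma_star_optimal g : couplings rho g ->
  is_gamma_star c eps Phi rho (emb w) g ->
  primal c eps Phi rho g = dual c eps Phi rho (emb w).
Proof.
move=> cg gs.
have mD : measurable_fun [set: XN] (conjugate' Phi \o slack c eps (emb w)).
  by apply: measurable_density => i; exact/measurable_EFinP.
have gr : g `<< rhoN.
  apply/null_content_dominatesP => A mA A0; rewrite gs//.
  by apply: null_set_integral => //; exact: measurable_funTS.
have mf := measurable_int _ (Radon_Nikodym_SigmaFinite.f_integrable gr).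
(* Both functions are densities of [g], so they agree almost everywhere, and the gap vanishes by
   [young_eq]. *)
have fE : ae_eq rhoN setT (RN g) (conjugate' Phi \o slack c eps (emb w)).
  apply: integral_ae_eq => //.
    exact: Radon_Nikodym_SigmaFinite.f_integrable.
  move=> A _ mA; rewrite -(Radon_Nikodym_SigmaFinite.f_integral gr)//.
  exact: gs.
rewrite duality_gap// [X in _ + _ * X](_ : _ = 0) ?mule0 ?adde0//.
have g0 : ae_eq rhoN setT (gap g) (cst 0).
  apply: (ae_impl fE) => x /(_ I) /= fx _.
  rewrite /gap fx slack_emb /= young_eq// -EFinD /=.
  by congr EFin; lra.
rewrite (ae_eq_integral (cst 0))//; first exact: integral0.
exact: measurable_gap.
Qed.

End integrable_potentials.

End real_potentials.

(** * First-order conditions *)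

Section first_order.
Context {R : realType} {N : nat} {X : 'I_N -> completeMetricType R}.
Variables (c : (forall i, X i) -> R) (eps : R) (Phi : \bar R -> \bar R).
Variable rho : forall i, probability (borel (X i)) R.
Local Open Scope ereal_scope.

Local Notation XN := (prod_space (fun i => borel (X i))).
Local Notation rhoN := (product_prob rho).
Local Notation psi := (fun r : R => fine (conjugate Phi r%:E)).
Local Notation dpsi := (derive1 psi).
Local Notation rsl := (rslack c eps).

Hypothesis eps0 : (0 < eps)%R.
Hypothesis mc : measurable_fun [set: XN] c.
Variable M : R.
Hypothesis cM : forall x, (`|c x| <= M)%R.
Hypothesis hPhi : is_entropy Phi.
Hypothesis dPsi :
  forall s : R, derivable (fun r : R => fine (conjugate Phi r%:E)) s 1.

Unset Implicit Arguments.
Variable w : forall i, X i -> R.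
Set Implicit Arguments.
Hypothesis mw : forall i, measurable_fun [set: borel (X i)] (w i).
Hypothesis iw : forall i, (rho i).-integrable setT (EFin \o (w i : borel (X i) -> R)).
Hypothesis ip : rhoN.-integrable setT (EFin \o (psi \o rsl w)).

Let perturbed i (A : set (X i)) (t : R) : X i -> R :=
  fun x => (w i x + t * \1_A x)%R.

Lemma rslack_perturbed i (A : set (X i)) t x :
  rsl (dfwith w i (@perturbed i A t)) x =
  (rsl w x + t * \1_A (x i) / eps)%R.
Proof.
rewrite /rslack -mulrDl addrAC; congr (_ * _ )%R; congr (_ - _)%R.
rewrite (bigD1 i)//= dfwithin [in RHS](bigD1 i)//= /perturbed addrAC.
by congr (_ + _ + _)%R; apply: eq_bigr => j ji; rewrite dfwithout// eq_sym.
Qed.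

Lemma measurable_perturbed i (A : set (borel (X i))) t : measurable A ->
  measurable_fun [set: borel (X i)] (@perturbed i A t).
Proof.
move=> mA; apply: measurable_funD; first exact: mw.
by apply: measurable_funM => //; exact: measurable_indic.
Qed.

Lemma perturbed_integrable i (A : set (borel (X i))) t : measurable A ->
  (rho i).-integrable [set: borel (X i)] (EFin \o (@perturbed i A t)).
Proof.
move=> mA; have : (rho i).-integrable [set: borel (X i)]
    ((EFin \o (w i : borel (X i) -> R)) \+ (fun x => t%:E * (\1_A x)%:E)).
  apply: integrableD => //.
  by apply: integrableZl => //; exact: integrable_indic.
by congr (_.-integrable _ _); apply/funext => x; rewrite /= /perturbed EFinD EFinM.
Qed.

Lemma perturbed_integral i (A : set (borel (X i))) t : measurable A ->
  \int[rho i]_x (@perturbed i A t x)%:E =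
  \int[rho i]_x (w i x)%:E + t%:E * rho i A.
Proof.
move=> mA; under eq_integral => x _ do rewrite /perturbed EFinD EFinM.
rewrite integralD//; last first.
  by apply: integrableZl => //; exact: integrable_indic.
by rewrite integralZl//; [rewrite integral_indic// setIT|exact: integrable_indic].
Qed.

Variable i : 'I_N.
Hypothesis maximal : forall v : X i -> R, potentials eps Phi rho (EFin \o v) ->
  dual c eps Phi rho (emb (dfwith w i v)) <= dual c eps Phi rho (emb w).

Lemma perturbation (A : set (borel (X i))) t : measurable A ->
  potentials eps Phi rho (EFin \o (@perturbed i A t)) ->
  rhoN.-integrable setT (EFin \o (psi \o rsl (dfwith w i (@perturbed i A t)))) ->
  (t / eps)%:E * rho i A <=
  \int[rhoN]_(x in [set x | A (x i)])
    (psi (rsl w x + t / eps) - psi (rsl w x))%:E.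
Proof.
move=> mA pA ipA; have := maximal pA; rewrite !(dual_emb _ _ _ hPhi).
rewrite (bigD1 i)//= dfwithin [X in _ <= X - _](bigD1 i)//= perturbed_integral//.
rewrite [X in _ + _ + X - _](eq_bigr (fun j => \int[rho j]_x (w j x)%:E)); last first.
  by move=> j ji; rewrite dfwithout// eq_sym.
(* Off the cylinder over [A] the two slacks coincide, so the difference of the integrals is carried
   by the cylinder. *)
have -> : \int[rhoN]_(x in [set x | A (x i)])
      (psi (rsl w x + t / eps) - psi (rsl w x))%:E =
    \int[rhoN]_x (psi (rsl (dfwith w i (@perturbed i A t)) x))%:E -
    \int[rhoN]_x (psi (rsl w x))%:E.
  rewrite -integralB//. rewrite [LHS]integral_mkcond; apply: eq_integral => x _.
  rewrite patchE /= rslack_perturbed indicE; case: ifPn => xA.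
    by rewrite (_ : x i \in A = true) ?mulr1//; move: xA; rewrite !inE.
  rewrite (_ : x i \in A = false) ?mulr0 ?mul0r ?addr0 -?EFinB ?subrr//.
  by apply/negbTE; move: xA; rewrite !notin_setE.
have := integrable_fin_num measurableT ip.
have := integrable_fin_num measurableT ipA.
rewrite /=; move: (\int[rhoN]_x _) => b' /fineK <-.
move: (\int[rhoN]_x _) => b /fineK <-.
have : \int[rho i]_x (w i x)%:E \is a fin_num.
  exact: integrable_fin_num (iw i).
move: (\int[rho i]_x (w i x)%:E) => a /fineK <-.
have : \sum_(j < N | j != i) \int[rho j]_x (w j x)%:E \is a fin_num.
  by rewrite sum_fin_num; apply/allP => _ /mapP[j _ ->]; exact: integrable_fin_num (iw j).
move: (\sum_(j < N | j != i) _) => r /fineK <-.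
have : rho i A \is a fin_num by exact: fin_num_measure.
move: (rho i A) => p /fineK <-.
do ?[rewrite -EFinM|rewrite -EFinB|rewrite -EFinD]; rewrite !lee_fin => h.
by rewrite mulrAC ler_pdivrMr//; lra.
Qed.

Let B (A : set (borel (X i))) : set XN := [set x | A (x i)].

Let mB A : measurable A -> measurable (B A).
Proof. exact: (@measurable_cylinder N _ (fun i => borel (X i))). Qed.

Let measurable_psi_shift t :
  measurable_fun [set: XN] (fun x => psi (rsl w x + t))%R.
Proof.
apply: (@measurableT_comp _ _ _ _ _ _ psi).
  by apply: continuous_measurable_fun; exact: conjugate_continuous.
by apply: measurable_funD => //; exact: measurable_rslack.
Qed.

Let measurable_dpsi_shift t :
  measurable_fun [set: XN] (fun x => dpsi (rsl w x + t))%R.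
Proof.
apply: (@measurableT_comp _ _ _ _ _ _ dpsi).
  by apply: continuous_measurable_fun; exact: conjugate'_continuous.
by apply: measurable_funD => //; exact: measurable_rslack.
Qed.

(** Integrability is automatic here because [Psi] is monotone. With [d = t / eps], the gradient
    inequality at the lowered slack gives [d Psi'(s - d) <= Psi s - Psi(s - d)]. *)
Lemma perturbation_down (A : set (borel (X i))) (t : R) : measurable A -> (0 < t)%R ->
  potentials eps Phi rho (EFin \o (@perturbed i A (- t))) ->
  \int[rhoN]_(x in [set x | A (x i)]) (dpsi (rsl w x - t / eps))%:E <= rho i A.
Proof.
move=> mA t0 pA.
have ipA : rhoN.-integrable setT (EFin \o (psi \o rsl (dfwith w i (@perturbed i A (- t))))).
  have mw' j : measurable_fun [set: borel (X j)] (dfwith w i (@perturbed i A (- t)) j).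
    by case: dfwithP => //; exact: measurable_perturbed.
  have iw' j : (rho j).-integrable [set: borel (X j)]
      (EFin \o (dfwith w i (@perturbed i A (- t)) j : borel (X j) -> R)).
    by case: dfwithP => //; exact: perturbed_integrable.
  have i1 := rslack_integrable eps mc cM iw' (product_coupling rho).
  apply: (integrable_between _ i1 ip).
  - exact: measurable_psi_rslack.
  - by move=> x /=; rewrite lee_fin (conjugate_ge_id hPhi).
  - move=> x /=; rewrite lee_fin (conjugate_homo hPhi dPsi)// rslack_perturbed gerDl.
    by rewrite -mulrA mulNr oppr_le0 mulr_ge0 ?(ltW t0)// divr_ge0 ?(ltW eps0).
have := perturbation mA pA ipA.
have te : (0 < t / eps)%R by rewrite divr_gt0.
under eq_integral => x _ do rewrite mulNr -opprB EFinN.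
rewrite integral_ge0N; last first.
  move=> x _; rewrite lee_fin subr_ge0 (conjugate_homo hPhi dPsi)// gerDl oppr_le0.
  exact: ltW.
rewrite mulNr EFinN mulNe leeN2 => h.
rewrite -(lee_pmul2l (_ : (t / eps)%:E \is a fin_num))// ?lte_fin//.
apply: le_trans h; rewrite -ge0_integralZl//; last 4 first.
- exact: mB.
- by apply/measurable_EFinP; apply: measurable_funTS; exact: measurable_dpsi_shift.
- by move=> x _; rewrite lee_fin (conjugate'_ge0 hPhi dPsi).
- by rewrite lee_fin ltW.
apply: ge0_le_integral => //.
- exact: mB.
- by move=> x _; rewrite -EFinM lee_fin mulr_ge0 ?(conjugate'_ge0 hPhi dPsi)// ltW.
- apply: measurable_funTS; apply/measurable_EFinP.
  by apply: measurable_funM => //; exact: measurable_dpsi_shift.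
- apply: measurable_funTS; apply/measurable_EFinP.
  apply: measurable_funB; last exact: measurable_psi_shift.
  by apply/measurable_EFinP; exact: measurable_psi_rslack.
move=> x _; rewrite -EFinM lee_fin.
have := conjugate_gradient hPhi dPsi (rsl w x - t / eps) (rsl w x).
by lra.
Qed.

(** The gradient inequality is again taken at the perturbed slack,
    [Psi(s + d) - Psi s <= d Psi'(s + d)], but admissibility and integrability now have to be
    assumed. *)
Lemma perturbation_up (A : set (borel (X i))) (t : R) : measurable A -> (0 < t)%R ->
  potentials eps Phi rho (EFin \o (@perturbed i A t)) ->
  rhoN.-integrable setT (EFin \o (psi \o rsl (dfwith w i (@perturbed i A t)))) ->
  rho i A <= \int[rhoN]_(x in [set x | A (x i)]) (dpsi (rsl w x + t / eps))%:E.
Proof.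
move=> mA t0 pA ipA; have h := perturbation mA pA ipA.
have te : (0 < t / eps)%R by rewrite divr_gt0.
rewrite -(lee_pmul2l (_ : (t / eps)%:E \is a fin_num))// ?lte_fin//.
apply: (le_trans h); rewrite -ge0_integralZl//; last 4 first.
- exact: mB.
- by apply/measurable_EFinP; apply: measurable_funTS; exact: measurable_dpsi_shift.
- by move=> x _; rewrite lee_fin (conjugate'_ge0 hPhi dPsi).
- by rewrite lee_fin ltW.
apply: ge0_le_integral => //.
- exact: mB.
- move=> x _; rewrite lee_fin subr_ge0 (conjugate_homo hPhi dPsi)// lerDl.
  exact: ltW.
- apply: measurable_funTS; apply/measurable_EFinP.
  apply: measurable_funB; first exact: measurable_psi_shift.
  by apply/measurable_EFinP; exact: measurable_psi_rslack.
- apply: measurable_funTS; apply/measurable_EFinP.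
  by apply: measurable_funM => //; exact: measurable_dpsi_shift.
move=> x _; rewrite -EFinM lee_fin.
have := conjugate_gradient hPhi dPsi (rsl w x + t / eps) (rsl w x).
by lra.
Qed.

Lemma potentialsP (v : X i -> R) : potentials eps Phi rho (EFin \o v) <->
  measurable_fun [set: borel (X i)] v /\
  0 < \int[rho i]_x (psi (v x / eps))%:E < +oo.
Proof.
have E : \int[rho i]_x conjugate Phi ((EFin \o v) x * (eps^-1)%:E) =
    \int[rho i]_x (psi (v x / eps))%:E.
  by apply: eq_integral => x _; rewrite /= -EFinM (conjugateE hPhi).
split=> [[mv _]|[mv vi]]; first by rewrite E; split=> //; exact/measurable_EFinP.
by split; [exact/measurable_EFinP|move=> x; exact: ltry|rewrite E].
Qed.

Lemma measurable_psi_potential (v : X i -> R) :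
  measurable_fun [set: borel (X i)] v ->
  measurable_fun [set: borel (X i)] (fun x => psi (v x / eps)%R).
Proof.
move=> mv; apply: (@measurableT_comp _ _ _ _ _ _ psi).
  by apply: continuous_measurable_fun; exact: conjugate_continuous.
exact: measurable_funM.
Qed.

Hypothesis wi_pot : potentials eps Phi rho (EFin \o w i).

Let iwe : (rho i).-integrable [set: borel (X i)] (fun x => (w i x / eps)%:E).
Proof.
have := integrableZl measurableT (eps^-1) (iw i).
by congr (_.-integrable _ _); apply/funext => x /=; rewrite -EFinM mulrC.
Qed.

Lemma psi_potential_integrable :
  (rho i).-integrable [set: borel (X i)] (fun x => (psi (w i x / eps))%:E).
Proof.
have [mv /andP[_ wy]] := (potentialsP _).1 wi_pot.
apply: (integrable_ge _ iwe) => //.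
- by apply/measurable_EFinP; exact: measurable_psi_potential.
- by move=> x; rewrite lee_fin (conjugate_ge_id hPhi).
Qed.

Let perturbed_cvg (A : set (borel (X i))) x s :
  perturbed A (s * harmonic n) x @[n --> \oo] --> w i x.
Proof.
rewrite -[X in _ --> X]addr0; apply: cvgD; first exact: cvg_cst.
rewrite -[X in _ --> X](mul0r (\1_A x)); apply: cvgM; last exact: cvg_cst.
by rewrite -(mulr0 s); apply: cvgM; [exact: cvg_cst|exact: cvg_harmonic].
Qed.

(** Lowering a potential may destroy the condition [0 < \int Psi]. The integral depends continuously
    on the perturbation, by dominated convergence, so a small enough one is admissible. *)
Lemma perturbed_down_potentials (A : set (borel (X i))) : measurable A ->
  \forall n \near \oo, potentials eps Phi rho (EFin \o (@perturbed i A (- harmonic n))).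
Proof.
move=> mA; have [_ /andP[w0 wy]] := (potentialsP _).1 wi_pot.
pose F (n : nat) x := (psi (@perturbed i A (- harmonic n) x / eps))%:E.
(* Since [harmonic n <= 1], the values lie between [w i x / eps - eps^-1], by [Psi s >= s], and
   [psi (w i x / eps)], by monotonicity. *)
pose G x := `|(psi (w i x / eps))%:E| + (`|(w i x / eps)%:E| + (eps^-1)%:E).
have h0 n x : (0 <= (harmonic n : R) * \1_A x <= 1)%R.
  rewrite !indicE; case: (_ \in _); rewrite ?mulr1 ?mulr0 ?lexx ?ler01//.
  by rewrite /harmonic /= invr_ge0 ler0n /= invf_le1 ?ltr0n// ler1n.
have FG n x : `|F n x| <= G x.
  have h1 : (psi (@perturbed i A (- harmonic n) x / eps) <= psi (w i x / eps))%R.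
    rewrite (conjugate_homo hPhi dPsi)// ler_pM2r ?invr_gt0// /perturbed gerDl.
    by rewrite mulNr oppr_le0; case/andP: (h0 n x).
  have h2 := conjugate_ge_id hPhi (@perturbed i A (- harmonic n) x / eps).
  have h3 : (w i x / eps - eps^-1 <= @perturbed i A (- harmonic n) x / eps)%R.
    rewrite -[X in (_ - X)%R]mul1r -mulrBl ler_pM2r ?invr_gt0// /perturbed mulNr lerD2l lerN2.
    by case/andP: (h0 n x).
  rewrite /F /G -!EFinD lee_fin.
  have k0 : (0 < eps^-1)%R by rewrite invr_gt0.
  move: h1 h2 h3; set a := psi (@perturbed _ _ _ _ / eps)%R.
  set b := psi (w i x / eps)%R; set e := (w i x / eps)%R; set f := (_ / eps)%R.
  move: k0; set k := (eps^-1)%R => k0 h1 h2 h3.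
  have := ler_norm b; have := ler_norm (- e)%R; rewrite normrN.
  have := ler_norm e; have := ler_norm (- b)%R; rewrite normrN => q1 q2 q3 q4.
  by rewrite ler_norml; apply/andP; split; lra.
have iG : (rho i).-integrable [set: borel (X i)] G.
  apply: integrableD => //; first by apply: integrable_abse; exact: psi_potential_integrable.
  apply: integrableD => //; first exact: integrable_abse.
  exact: finite_measure_integrable_cst.
have mF n : measurable_fun [set: borel (X i)] (F n).
  by apply/measurable_EFinP; apply: measurable_psi_potential; exact: measurable_perturbed.
have cF x : F n x @[n --> \oo] --> (psi (w i x / eps))%:E.
  apply: (@cvg_EFin_comp _ psi); first exact: conjugate_continuous.
  apply: cvgM; last exact: cvg_cst.
  have := @perturbed_cvg A x (-1)%R.
  by under eq_fun do rewrite mulN1r.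
have mp : measurable_fun [set: borel (X i)] (fun x => (psi (w i x / eps))%:E).
  by apply/measurable_EFinP; exact: measurable_psi_potential.
have [_ _ Fcvg] := dominated_convergence measurableT mF mp
  (aeW (rho i) (fun x _ => cF x)) iG (aeW (rho i) (fun x n _ => FG n x)).
have F0 : \forall n \near \oo, 0 < \int[rho i]_x F n x.
  exact: (Fcvg _ (open_nbhs_nbhs (conj (@open_ereal_gt_ereal R 0) w0))).
apply: filterS F0 => n Fn; apply/potentialsP; split.
  exact: measurable_perturbed.
rewrite Fn /=; apply: integrable_lty => //.
by apply: (le_integrable measurableT (mF n) _ iG) => x _; rewrite (le_trans (FG n x))// lee_abs.
Qed.

(** Limit of [perturbation_down]. The integrands are nonnegative and increase to [Psi'(s)], so
    monotone convergence applies although nothing dominates [Psi'(s)] yet. *)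
Lemma marginal_le (A : set (borel (X i))) : measurable A ->
  \int[rhoN]_(x in [set x | A (x i)]) (dpsi (rsl w x))%:E <= rho i A.
Proof.
move=> mA.
pose f (n : nat) x := (dpsi (rsl w x - harmonic n / eps))%:E.
have cf x : f n x @[n --> \oo] --> (dpsi (rsl w x))%:E.
  apply: (@cvg_EFin_comp _ dpsi); first exact: conjugate'_continuous.
  rewrite -[X in _ --> X]subr0; apply: cvgB; first exact: cvg_cst.
  by rewrite -(mul0r (eps^-1)%R); apply: cvgM; [exact: cvg_harmonic|exact: cvg_cst].
have hf (n m : nat) x : (n <= m)%N -> f n x <= f m x.
  move=> nm; rewrite /f lee_fin (conjugate'_homo hPhi dPsi)// lerD2l lerN2.
  by rewrite ler_pM2r ?invr_gt0//= lef_pV2 ?posrE ?ltr0n// ler_nat ltnS.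
have : \int[rhoN]_(x in [set x | A (x i)]) f n x @[n --> \oo] -->
    \int[rhoN]_(x in [set x | A (x i)]) (dpsi (rsl w x))%:E.
  have -> : \int[rhoN]_(x in [set x | A (x i)]) (dpsi (rsl w x))%:E =
      \int[rhoN]_(x in [set x | A (x i)]) lim (f n x @[n --> \oo]).
    by apply: eq_integral => x _; apply/esym/cvg_lim => //; exact: cf.
  apply: cvg_monotone_convergence.
  - exact: mB.
  - move=> n; apply: measurable_funTS; apply/measurable_EFinP.
    exact: measurable_dpsi_shift.
  - by move=> n x _; rewrite lee_fin (conjugate'_ge0 hPhi dPsi).
  - by move=> x _ n m; exact: hf.
move=> /cvge_to_le; apply.
apply: filterS (perturbed_down_potentials mA) => n pn.
by apply: (perturbation_down mA _ pn); rewrite /= invr_gt0 ltr0n.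
Qed.

Section bounded_above.
Variable K : R.
Hypothesis wK : forall j x, (w j x <= K)%R.

Let rsl_le x : (rsl w x <= (N%:R * K + M) / eps)%R.
Proof.
rewrite /rslack ler_pM2r ?invr_gt0// lerD//.
  rewrite (le_trans (ler_sum _ (fun j _ => wK (x j))))//.
  by rewrite sumr_const card_ord mulr_natl.
by apply: le_trans (cM x); rewrite -normrN ler_norm.
Qed.

(** Raising a potential can only increase the integral of [Psi], so positivity is kept; finiteness
    comes from the bound [K]. *)
Let perturbed_up_potentials (A : set (borel (X i))) (t : R) : measurable A -> (0 < t)%R ->
  potentials eps Phi rho (EFin \o (@perturbed i A t)).
Proof.
move=> mA t0; apply/potentialsP; split; first exact: measurable_perturbed.
have mp : measurable_fun [set: borel (X i)] (fun x => (psi (@perturbed i A t x / eps))%:E).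
  by apply/measurable_EFinP; apply: measurable_psi_potential; exact: measurable_perturbed.
have le1 x : (psi (w i x / eps) <= psi (@perturbed i A t x / eps))%R.
  rewrite (conjugate_homo hPhi dPsi)// ler_pM2r ?invr_gt0// /perturbed lerDl.
  by rewrite mulr_ge0 ?(ltW t0).
have ipt : (rho i).-integrable [set: borel (X i)]
    (fun x => (psi (@perturbed i A t x / eps))%:E).
  apply: (integrable_between (h2 := cst (psi ((K + t) / eps))%:E) mp
    psi_potential_integrable) => //.
  - exact: finite_measure_integrable_cst.
  - move=> x; rewrite lee_fin (conjugate_homo hPhi dPsi)// ler_pM2r ?invr_gt0// /perturbed.
    rewrite lerD// indicE; case: (_ \in _); rewrite ?mulr1// mulr0; exact: ltW.
have [_ /andP[w0 wy]] := (potentialsP _).1 wi_pot.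
rewrite integrable_lty// andbT (lt_le_trans w0)//.
by apply: le_integral => //; [exact: psi_potential_integrable|move=> x _; rewrite lee_fin].
Qed.

(** The integrands now decrease to [Psi'(s)], so a dominating function is needed; the bound [K] on
    the potentials supplies a constant. *)
Lemma marginal_ge (A : set (borel (X i))) : measurable A ->
  rho i A <= \int[rhoN]_(x in [set x | A (x i)]) (dpsi (rsl w x))%:E.
Proof.
move=> mA.
pose f (n : nat) x := (dpsi (rsl w x + harmonic n / eps))%:E.
have cf x : f n x @[n --> \oo] --> (dpsi (rsl w x))%:E.
  apply: (@cvg_EFin_comp _ dpsi); first exact: conjugate'_continuous.
  rewrite -[X in _ --> X]addr0; apply: cvgD; first exact: cvg_cst.
  by rewrite -(mul0r (eps^-1)%R); apply: cvgM; [exact: cvg_harmonic|exact: cvg_cst].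
have mf n : measurable_fun [set x : XN | A (x i)] (f n).
  apply: measurable_funTS; apply/measurable_EFinP.
  exact: measurable_dpsi_shift.
(* Bound for [s + harmonic n / eps], since [harmonic n <= 1]. *)
pose C := ((N%:R * K + M) / eps + eps^-1)%R.
have h1 n : (harmonic n / eps <= eps^-1 :> R)%R.
  by rewrite ler_piMl ?invr_ge0 ?(ltW eps0)//= invf_le1 ?ltr0n// ler1n.
have fC x n : `|f n x| <= (dpsi C)%:E.
  rewrite /f gee0_abs ?lee_fin ?(conjugate'_ge0 hPhi dPsi)//.
  by rewrite (conjugate'_homo hPhi dPsi)// lerD// rsl_le.
have mD : measurable_fun [set x : XN | A (x i)] (fun x => (dpsi (rsl w x))%:E).
  by apply: measurable_funTS; apply/measurable_EFinP; exact: measurable_dpsi_rslack.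
have iC : rhoN.-integrable [set x : XN | A (x i)] (fun=> (dpsi C)%:E).
  by apply: finite_measure_integrable_cst; exact: mB.
have [_ _ Fcvg] := dominated_convergence (mB mA) mf mD
  (aeW rhoN (fun x _ => cf x)) iC (aeW rhoN (fun x n _ => fC x n)).
apply: (cvge_to_ge Fcvg); apply: nearW => n.
have t0 : (0 < harmonic n :> R)%R by rewrite /= invr_gt0 ltr0n.
apply: perturbation_up => //; first exact: perturbed_up_potentials.
have mw' j : measurable_fun [set: borel (X j)] (dfwith w i (@perturbed i A (harmonic n)) j).
  by case: dfwithP => //; exact: measurable_perturbed.
apply: (integrable_between (h2 := cst (psi C)%:E) _ ip) => //.
- exact: measurable_psi_rslack.
- exact: finite_measure_integrable_cst.
- move=> x /=; rewrite lee_fin (conjugate_homo hPhi dPsi)// rslack_perturbed lerDl.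
  by rewrite divr_ge0 ?(ltW eps0)// mulr_ge0 ?(ltW t0).
- move=> x /=; rewrite lee_fin (conjugate_homo hPhi dPsi)// rslack_perturbed lerD// ?rsl_le//.
  apply: le_trans (h1 n); rewrite ler_pM2r ?invr_gt0//.
  by rewrite indicE; case: (_ \in _); rewrite ?mulr1// mulr0 ltW.
Qed.

End bounded_above.

End first_order.

(** * Essential bounds *)

Section essential_bounds.
Context {R : realType} {N : nat} {X : 'I_N -> completeMetricType R}.
Variables (c : (forall i, X i) -> R) (eps : R) (Phi : \bar R -> \bar R).
Variable rho : forall i, probability (borel (X i)) R.
Local Open Scope ereal_scope.

Local Notation XN := (prod_space (fun i => borel (X i))).
Local Notation rhoN := (product_prob rho).
Local Notation psi := (fun r : R => fine (conjugate Phi r%:E)).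
Local Notation dpsi := (derive1 psi).
Local Notation rsl := (rslack c eps).

Hypothesis eps0 : (0 < eps)%R.
Hypothesis mc : measurable_fun [set: XN] c.
Variable M : R.
Hypothesis cM : forall x, (`|c x| <= M)%R.
Hypothesis hPhi : is_entropy Phi.
Hypothesis dPsi :
  forall s : R, derivable (fun r : R => fine (conjugate Phi r%:E)) s 1.

Unset Implicit Arguments.
Variable w : forall i, X i -> R.
Set Implicit Arguments.
Hypothesis mw : forall i, measurable_fun [set: borel (X i)] (w i).

Lemma measurable_level i (D : set R) : measurable D ->
  measurable ([set x | D (w i x)] : set (borel (X i))).
Proof. by move=> mD; have := @mw i measurableT _ mD; rewrite setTI. Qed.

(** The superlevel sets at [- n] exhaust the space because [w j] is finite everywhere, so they
    cannot all be null. *)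
Lemma superlevel_gt0 : exists2 L : R, (0 <= L)%R &
  forall j, 0 < rho j [set x | (- L <= w j x)%R].
Proof.
have mS (l : R) j : measurable ([set x | (- l <= w j x)%R] : set (borel (X j))).
  have := @measurable_level j `[(- l)%R, +oo[%classic (measurable_itv _).
  by congr measurable; apply/seteqP; split=> x /=; rewrite in_itv/= andbT.
have H j : exists n : nat, 0 < rho j [set x | (- n%:R <= w j x)%R].
  apply: contrapT => /forallNP h.
  have : (rho j).-negligible (\bigcup_n [set x : borel (X j) | (- n%:R <= w j x)%R]).
    apply: negligible_bigcup => n; apply/negligibleP; first exact: mS.
    by apply/eqP; rewrite eq_le measure_ge0 andbT leNgt; apply/negP/h.
  rewrite (_ : \bigcup_n _ = setT); last first.
    apply/seteqP; split=> // x _; exists (Num.truncn `|w j x|).+1 => //=.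
    rewrite lerNl (le_trans (ler_norm _))// normrN ltW//.
    exact: truncnS_gt.
  move=> /negligibleP -/(_ measurableT) r0.
  have /eqP := etrans (esym (probability_setT (rho j))) r0.
  by rewrite onee_eq0.
have [n hn] := choice H.
(* The sum dominates every [n j] and serves as a common level. *)
exists (\sum_j n j)%:R => [|j]; first by rewrite ler0n.
apply: lt_le_trans (hn j) _; apply: le_measure; rewrite ?inE; try exact: mS.
move=> x /=; apply: le_trans; rewrite lerN2 ler_nat (bigD1 j)//=.
exact: leq_addr.
Qed.

Lemma essentially_bounded_above i :
  (forall A : set (borel (X i)), measurable A ->
    \int[rhoN]_(x in [set x | A (x i)]) (dpsi (rsl w x))%:E <= rho i A) ->
  exists K : R, {ae rho i, forall x, (w i x <= K)%R}.
Proof.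
move=> marg; have [L L0 hL] := superlevel_gt0.
have mS j : measurable ([set x | (- L <= w j x)%R] : set (borel (X j))).
  have := @measurable_level j `[(- L)%R, +oo[%classic (measurable_itv _).
  by congr measurable; apply/seteqP; split=> x /=; rewrite in_itv/= andbT.
pose q j := fine (rho j [set x | (- L <= w j x)%R]).
have qE j : rho j [set x | (- L <= w j x)%R] = (q j)%:E.
  by rewrite fineK//; apply: fin_num_measure; exact: mS.
have q0 j : (0 < q j)%R by rewrite -lte_fin -qE.
(* Mass of the sides other than [i] of the box. With [Psi' y] above its inverse, the marginal
   inequality becomes [Psi' y * delta * rho i A <= rho i A] with a factor above 1, so [A] is
   null. *)
pose delta := (\prod_(j < N | j != i) q j)%R.
have delta0 : (0 < delta)%R by apply: prodr_gt0.
have [y hy] := conjugate'_large hPhi dPsi (delta^-1)%R.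
(* On the box the other potentials add up to at least [- N L] and [c <= M], so [w i > K] forces the
   slack above [y]. *)
pose K := (y * eps + N%:R * L + M)%R.
exists K; pose A : set (borel (X i)) := [set x | (K < w i x)%R].
have mA : measurable A.
  have := @measurable_level i `]K, +oo[%classic (measurable_itv _).
  by congr measurable; apply/seteqP; split=> x /=; rewrite in_itv/= andbT.
suff A0 : rho i A = 0.
  by exists A; split=> // x /= /negP; rewrite -ltNge.
pose D : forall j, set (borel (X j)) := @dfwith _ (fun j => set (borel (X j)))
  (fun j => [set x | (- L <= w j x)%R]) i A.
have mD j : measurable (D j) by rewrite /D; case: dfwithP.
have mBD : measurable ([set x | forall j, D j (x j)] : set XN).
  exact: (@measurable_box N _ (fun j => borel (X j))).
have boxE : rhoN [set x | forall j, D j (x j)] = rho i A * delta%:E.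
  rewrite (product_probE rho)// (bigD1 i)//= /D dfwithin; congr (_ * _).
  rewrite -prodEFin; apply: eq_bigr => j ji.
  by rewrite dfwithout 1?eq_sym// qE.
have le_y x : (forall j, D j (x j)) -> (y <= rsl w x)%R.
  move=> Dx; rewrite /rslack ler_pdivlMr//.
  have wi : (K < w i (x i))%R by have := Dx i; rewrite /D dfwithin.
  have wj : (- (N%:R * L) <= \sum_(j < N | j != i) w j (x j))%R.
    apply: (@le_trans _ _ (\sum_(j < N | j != i) - L)%R); last first.
      apply: ler_sum => j ji; have := Dx j.
      by rewrite /D dfwithout 1?eq_sym.
    rewrite sumr_const mulNrn lerN2 -[leLHS]mulr_natl ler_wpM2r// ler_nat.
    by rewrite (leq_trans (max_card _))// card_ord.
  have cx : (c x <= M)%R by rewrite (le_trans _ (cM x))// ler_norm.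
  by rewrite (bigD1 i)//=; move: wi; rewrite /K; lra.
have : (dpsi y * delta)%:E * rho i A <= rho i A.
  apply: le_trans (marg _ mA).
  apply: (@le_trans _ _ (\int[rhoN]_(x in [set x | forall j, D j (x j)])
      (dpsi (rsl w x))%:E)); last first.
    apply: ge0_subset_integral => //.
    - exact: (@measurable_cylinder N _ (fun i => borel (X i))).
    - apply: measurable_funTS; apply/measurable_EFinP.
      exact: measurable_dpsi_rslack.
    - by move=> x _; rewrite lee_fin (conjugate'_ge0 hPhi dPsi).
    - by move=> x /= /(_ i); rewrite /D dfwithin.
  apply: (@le_trans _ _ (\int[rhoN]_(x in [set x | forall j, D j (x j)])
      (dpsi y)%:E)); last first.
    apply: ge0_le_integral => //.
    - by move=> x _; rewrite lee_fin (conjugate'_ge0 hPhi dPsi).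
    - apply: measurable_funTS; apply/measurable_EFinP.
      exact: measurable_dpsi_rslack.
    - by move=> x Dx; rewrite lee_fin (conjugate'_homo hPhi dPsi)// le_y.
  rewrite EFinM -muleA [delta%:E * _]muleC -boxE le_eqVlt; apply/orP; left.
  by apply/eqP/esym; exact: integral_cst.
have : (1 < dpsi y * delta)%R by rewrite -ltr_pdivrMr// div1r.
have : rho i A \is a fin_num by exact: fin_num_measure.
have : 0 <= rho i A by exact: measure_ge0.
case: (rho i A) => [p||]// p0 _ h ple; move: p0 ple; rewrite -EFinM !lee_fin => p0 ple.
suff -> : p = 0%R by [].
apply/eqP; rewrite eq_le p0 andbT leNgt; apply/negP => pp.
by move: ple; rewrite -[leRHS]mul1r ler_pM2r// leNgt h.
Qed.

(** The other potentials are bounded above everywhere, so the whole cylinder over [A] can replace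
    the box. There [Psi'] of the slack is at most some [Psi' y < 1], which makes [A] null. *)
Lemma essentially_bounded_below i (K : R) : (forall j x, (w j x <= K)%R) ->
  (forall A : set (borel (X i)), measurable A ->
    rho i A <= \int[rhoN]_(x in [set x | A (x i)]) (dpsi (rsl w x))%:E) ->
  exists L : R, {ae rho i, forall x, (L <= w i x)%R}.
Proof.
move=> wK marg.
have [y hy] := conjugate'_small hPhi dPsi (@ltr01 R).
(* The absolute value is there because [K] may be negative, while the [N - 1] other potentials are
   estimated by [N] terms. *)
pose L := (y * eps - N%:R * `|K| - M)%R.
exists L; pose A : set (borel (X i)) := [set x | (w i x < L)%R].
have mA : measurable A.
  have := @measurable_level i `]-oo, L[%classic (measurable_itv _).
  by congr measurable; apply/seteqP; split=> x /=; rewrite in_itv.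
suff A0 : rho i A = 0.
  by exists A; split=> // x /= /negP; rewrite -ltNge.
have mB : measurable ([set x | A (x i)] : set XN).
  exact: (@measurable_cylinder N _ (fun i => borel (X i))).
have le_y x : A (x i) -> (rsl w x <= y)%R.
  move=> Ax; rewrite /rslack ler_pdivrMr//.
  have wj : (\sum_(j < N | j != i) w j (x j) <= N%:R * `|K|)%R.
    apply: (@le_trans _ _ (\sum_(j < N | j != i) `|K|)%R).
      by apply: ler_sum => j ji; rewrite (le_trans (wK _ _))// ler_norm.
    rewrite sumr_const -[leLHS]mulr_natl ler_wpM2r// ler_nat.
    by rewrite (leq_trans (max_card _))// card_ord.
  have cx : (- c x <= M)%R by rewrite (le_trans _ (cM x))// -normrN ler_norm.
  by rewrite (bigD1 i)//=; move: Ax; rewrite /A /L /=; lra.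
have : rho i A <= (dpsi y)%:E * rho i A.
  apply: (le_trans (marg _ mA)).
  apply: (@le_trans _ _ (\int[rhoN]_(x in [set x | A (x i)]) (dpsi y)%:E)).
    apply: ge0_le_integral => //.
    - by move=> x _; rewrite lee_fin (conjugate'_ge0 hPhi dPsi).
    - apply: measurable_funTS; apply/measurable_EFinP.
      exact: measurable_dpsi_rslack.
    - by move=> x Dx; rewrite lee_fin (conjugate'_homo hPhi dPsi)// le_y.
  rewrite -(product_coupling rho mA) le_eqVlt; apply/orP; left.
  by apply/eqP; exact: integral_cst.
have : rho i A \is a fin_num by exact: fin_num_measure.
have : 0 <= rho i A by exact: measure_ge0.
case: (rho i A) => [p||]// p0 _ ple; move: p0 ple; rewrite -EFinM !lee_fin => p0 ple.
suff -> : p = 0%R by [].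
apply/eqP; rewrite eq_le p0 andbT leNgt; apply/negP => pp.
by move: ple; rewrite -[leLHS]mul1r ler_pM2r// leNgt hy.
Qed.

End essential_bounds.

(** * Reduction to finite potentials *)

Section optimality.
Context {R : realType} {N : nat} {X : 'I_N -> completeMetricType R}.
Variables (c : (forall i, X i) -> R) (eps : R) (Phi : \bar R -> \bar R).
Variable rho : forall i, probability (borel (X i)) R.
Local Open Scope ereal_scope.

Local Notation XN := (prod_space (fun i => borel (X i))).
Local Notation rhoN := (product_prob rho).
Local Notation psi := (fun r : R => fine (conjugate Phi r%:E)).
Local Notation dpsi := (derive1 psi).
Local Notation rsl := (rslack c eps).

Hypothesis eps0 : (0 < eps)%R.
Hypothesis mc : measurable_fun [set: XN] c.
Variable M : R.
Hypothesis cM : forall x, (`|c x| <= M)%R.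
Hypothesis hPhi : is_entropy Phi.
Hypothesis dPsi :
  forall s : R, derivable (fun r : R => fine (conjugate Phi r%:E)) s 1.

Implicit Types (u : forall i, X i -> \bar R) (w : forall i, X i -> R).
Implicit Type g : probability XN R.

Local Notation is_pot := (potentials eps Phi rho).

Lemma potentials_ae i (v v' : X i -> \bar R) : is_pot v ->
  measurable_fun [set: borel (X i)] v' -> (forall x, v' x < +oo) ->
  {ae rho i, forall x, v x = v' x} -> is_pot v'.
Proof.
move=> [mv vy hv] mv' vy' vv'; split => //.
rewrite (_ : \int[rho i]_x conjugate Phi (v' x * (eps^-1)%:E) =
  \int[rho i]_x conjugate Phi (v x * (eps^-1)%:E))//.
have mP (f : X i -> \bar R) : measurable_fun [set: borel (X i)] f ->
    measurable_fun [set: borel (X i)] (fun x => conjugate Phi (f x * (eps^-1)%:E)).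
  move=> mf; apply: (@measurableT_comp _ _ _ _ _ _ (conjugate Phi)).
    exact: measurable_conjugate.
  by apply: emeasurable_funM => //; exact: measurable_cst.
apply: ae_eq_integral => //; [exact: mP|exact: mP|].
by apply: (ae_impl vv') => x ->.
Qed.

(** [v <= eps Psi(v / eps)] is an integrable majorant: membership in the class makes the integral of
    [Psi] finite, its positivity excluding [-oo]. *)
Lemma potential_integrable i (v : X i -> \bar R) : is_pot v ->
  -oo < \int[rho i]_x v x ->
  (rho i).-integrable [set: borel (X i)] (v : borel (X i) -> \bar R).
Proof.
move=> [mv vy /andP[P0 Py]] vN.
have mP : measurable_fun [set: borel (X i)] (fun x => conjugate Phi (v x * (eps^-1)%:E)).
  apply: (@measurableT_comp _ _ _ _ _ _ (conjugate Phi)).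
    exact: measurable_conjugate.
  by apply: emeasurable_funM => //; exact: measurable_cst.
have iP : (rho i).-integrable [set: borel (X i)]
    (fun x => conjugate Phi (v x * (eps^-1)%:E)).
  apply: fin_num_integrable => //; rewrite fin_numElt Py andbT.
  exact: lt_trans P0.
apply: (integrable_le mv (integrableZl measurableT eps iP) _ vN) => x.
case: (v x) (vy x) => [r _|//|_]; last by rewrite leNye.
rewrite -EFinM (conjugateE hPhi) -EFinM lee_fin -ler_pdivrMl// mulrC.
exact: conjugate_ge_id.
Qed.

Lemma dual_gtNy_integrable u : (forall i, is_pot (u i)) ->
  -oo < dual c eps Phi rho u ->
  forall i, (rho i).-integrable [set: borel (X i)] (u i : borel (X i) -> \bar R).
Proof.
move=> hu du i; apply: potential_integrable => //.
rewrite ltNye; apply: contraTN du => /eqP ui.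
by rewrite /dual (bigD1 i)//= ui !addNye ltxx.
Qed.

Lemma bounded_integrable i (f : X i -> R) (K : R) :
  measurable_fun [set: borel (X i)] f -> (forall x, (`|f x| <= K)%R) ->
  (rho i).-integrable [set: borel (X i)] (EFin \o (f : borel (X i) -> R)).
Proof.
move=> mf fK; apply: measurable_bounded_integrable => //.
  by rewrite (le_lt_trans (@probability_le1 _ _ _ (rho i) _ _))// ltry.
exists K; split; first exact: num_real.
by move=> y Ky x _; exact: le_trans (fK x) (ltW Ky).
Qed.

Section bounded_potentials.
Unset Implicit Arguments.
Variable w : forall i, X i -> R.
Set Implicit Arguments.
Variable K : R.
Hypothesis mw : forall i, measurable_fun [set: borel (X i)] (w i).
Hypothesis wK : forall i x, (`|w i x| <= K)%R.

Lemma bounded_rslack x : (`|rsl w x| <= (N%:R * K + M) / eps)%R.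
Proof.
rewrite /rslack normrM (gtr0_norm (_ : 0 < eps^-1)%R) ?invr_gt0//.
rewrite ler_pM2r ?invr_gt0// (le_trans (ler_normB _ _))// lerD//.
rewrite (le_trans (ler_norm_sum _ _ _))//.
rewrite (le_trans (ler_sum _ (fun j _ => wK (x j))))//.
by rewrite sumr_const card_ord mulr_natl.
Qed.

Lemma bounded_psi_integrable : rhoN.-integrable setT (EFin \o (psi \o rsl w)).
Proof.
pose C := ((N%:R * K + M) / eps)%R.
apply: (integrable_between (h1 := EFin \o cst (- C)%R) (h2 := EFin \o cst (psi C))).
- exact: measurable_psi_rslack.
- exact: finite_measure_integrable_cst.
- exact: finite_measure_integrable_cst.
- move=> x /=; rewrite lee_fin (le_trans _ (conjugate_ge_id hPhi _))//.
  by have := bounded_rslack x; rewrite ler_norml => /andP[].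
- move=> x /=; rewrite lee_fin (conjugate_homo hPhi dPsi)//.
  by have := bounded_rslack x; rewrite ler_norml => /andP[].
Qed.

End bounded_potentials.

Lemma dual_attainable : exists2 u, forall i, is_pot (u i) & -oo < dual c eps Phi rho u.
Proof.
(* The zero potentials are not admissible, since [Psi 0 = 0]; the constant 1 is, because
   [Psi (1 / eps) >= 1 / eps > 0]. *)
exists (emb (fun i (_ : X i) => 1%R)).
  move=> i; apply/potentialsP => //; split; first exact: measurable_cst.
  rewrite (_ : \int[rho i]_x _ = (psi (1 / eps)%R)%:E).
    by rewrite ltry andbT lte_fin (lt_le_trans _ (conjugate_ge_id hPhi _))// divr_gt0.
  rewrite integral_cst// [X in _ * X](_ : _ = 1) ?mule1//.
  exact: probability_setT.
have m1 i : measurable_fun [set: borel (X i)] (fun _ : X i => 1%R : R).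
  exact: measurable_cst.
have w1 i (x : X i) : (`|1 : R| <= 1)%R by rewrite normr1.
have := dual_emb_fin_num hPhi (fun i => bounded_integrable (m1 i) (@w1 i))
  (bounded_psi_integrable m1 w1).
by rewrite fin_numElt => /andP[].
Qed.

Lemma weak_duality_potentials u g : (forall i, is_pot (u i)) -> couplings rho g ->
  dual c eps Phi rho u <= primal c eps Phi rho g.
Proof.
move=> hu cg; have [->|dN] := eqVneq (dual c eps Phi rho u) -oo.
  exact: leNye.
have {}dN : -oo < dual c eps Phi rho u by rewrite ltNye.
have iu := dual_gtNy_integrable hu dN.
pose w i := fine \o u i.
have mu i : measurable_fun [set: borel (X i)] (u i) by case: (hu i).
have mw i : measurable_fun [set: borel (X i)] (w i) by exact: measurableT_comp.
have uw i : {ae rho i, forall x, u i x = emb w i x}.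
  have := integrable_ae measurableT (iu i) => /ae_impl; apply => x /(_ I).
  by rewrite /emb /w /= => /fineK.
have mew i : measurable_fun [set: borel (X i)] (emb w i) by exact/measurable_EFinP.
have iw i := ae_integrable (mew i) (uw i) (iu i).
rewrite (dual_ae eps mc hPhi dPsi mu mew uw) in dN *.
apply: weak_duality => //; apply: psi_integrable => //.
Qed.

(* Truncating above is harmless once the potentials are known to be essentially
   bounded above, and it makes the upward perturbations admissible. *)
Lemma maximal_coupling u : (0 < N)%N -> (forall i, is_pot (u i)) ->
  -oo < dual c eps Phi rho u ->
  (forall i (v : X i -> R), is_pot (EFin \o v) ->
    dual c eps Phi rho (dfwith u i (EFin \o v)) <= dual c eps Phi rho u) ->
  exists2 g, couplings rho g & is_gamma_star c eps Phi rho u g.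
Proof.
move=> hN hu dN umax.
have iu := dual_gtNy_integrable hu dN.
have mu i : measurable_fun [set: borel (X i)] (u i) by case: (hu i).
(* Stated for an arbitrary finite version of [u], because it is used for [w0] and again for its
   truncation. *)
have facts w : (forall i, measurable_fun [set: borel (X i)] (w i)) ->
    (forall i, {ae rho i, forall x, u i x = emb w i x}) ->
    [/\ forall i, (rho i).-integrable setT (EFin \o (w i : borel (X i) -> R)),
      rhoN.-integrable setT (EFin \o (psi \o rsl w)),
      forall i, is_pot (EFin \o w i) &
      forall i (v : X i -> R), is_pot (EFin \o v) ->
        dual c eps Phi rho (emb (dfwith w i v)) <= dual c eps Phi rho (emb w)].
  move=> mw uw.
  have mew i : measurable_fun [set: borel (X i)] (emb w i) by exact/measurable_EFinP.
  have iw i := ae_integrable (mew i) (uw i) (iu i).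
  have dw := dN; rewrite (dual_ae eps mc hPhi dPsi mu mew uw) in dw.
  split; first exact: iw.
  - exact: (psi_integrable eps0 mc cM hPhi dPsi mw iw dw).
  - by move=> i; apply: potentials_ae (hu i) (mew i) _ (uw i) => x; exact: ltry.
  move=> i v pv; rewrite -(dual_ae eps mc hPhi dPsi mu mew uw).
  have mv : measurable_fun [set: borel (X i)] (EFin \o v) by case: pv.
  rewrite -(@dual_ae _ _ _ c eps Phi rho mc hPhi dPsi (dfwith u i (EFin \o v))).
  - exact: umax.
  - by move=> j; case: dfwithP.
  - move=> j; apply/measurable_EFinP; case: dfwithP => //.
    exact/measurable_EFinP.
  - move=> j; rewrite /emb; have [ij|ij] := eqVneq i j.
      by subst j; apply: aeW => x; rewrite !dfwithin.
    by rewrite !dfwithout//; exact: uw.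
pose w0 i := fine \o u i.
have mw0 i : measurable_fun [set: borel (X i)] (w0 i) by exact: measurableT_comp.
have uw0 i : {ae rho i, forall x, u i x = emb w0 i x}.
  have := integrable_ae measurableT (iu i) => /ae_impl; apply => x /(_ I).
  by rewrite /emb /w0 /= => /fineK.
have [iw0 ip0 pw0 max0] := facts _ mw0 uw0.
have /choice[k hk] : forall i, exists k : R, {ae rho i, forall x, (w0 i x <= k)%R}.
  move=> i; apply: (essentially_bounded_above eps0 mc cM hPhi dPsi mw0) => A mA.
  exact: (marginal_le eps0 mc cM hPhi dPsi mw0 iw0 ip0 (max0 i) (pw0 i)).
(* A single level above all the essential bounds, so that truncating at [K] changes each potential
   on a null set only. *)
pose K := (\sum_i `|k i|)%R.
have kK i : (k i <= K)%R.
  by rewrite (le_trans (ler_norm _))// /K (bigD1 i)//= lerDl sumr_ge0.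
pose w i x := Num.min (w0 i x) K.
have mw i : measurable_fun [set: borel (X i)] (w i).
  by apply: measurable_minr => //; exact: measurable_cst.
have uw i : {ae rho i, forall x, u i x = emb w i x}.
  have H : {ae rho i, forall x, u i x = emb w0 i x /\ (w0 i x <= k i)%R}.
    exact: ae_and (uw0 i) (hk i).
  apply: (ae_impl H) => x [-> wk]; rewrite /emb /w min_l//.
  exact: le_trans (kK i).
have [iw ip pw wmax] := facts _ mw uw.
have wK i x : (w i x <= K)%R by rewrite /w ge_min lexx orbT.
have mew i : measurable_fun [set: borel (X i)] (emb w i) by exact/measurable_EFinP.
have marg i (A : set (borel (X i))) : measurable A ->
    \int[rhoN]_(x in [set x | A (x i)]) conjugate' Phi (slack c eps (emb w) x) = rho i A.
  move=> mA; under eq_integral => x _ do rewrite slack_emb /=.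
  apply/eqP; rewrite eq_le; apply/andP; split.
    exact: (marginal_le eps0 mc cM hPhi dPsi mw iw ip (wmax i) (pw i)).
  exact: (marginal_ge eps0 mc cM hPhi dPsi mw iw ip (wmax i) (pw i) wK).
have [g gE] : exists g : probability XN R, forall A, measurable A ->
    g A = \int[rhoN]_(x in A) (conjugate' Phi \o slack c eps (emb w)) x.
  apply: density_probability => [|x|].
  - exact: measurable_density.
  - exact: conjugate'e_ge0.
  (* The total mass is that of any marginal; an index exists since [0 < N]. *)
  - have := marg (Ordinal hN) _ measurableT.
    by rewrite probability_setT.
exists g.
  move=> i A mA; rewrite gE ?marg//.
  exact: (@measurable_cylinder N _ (fun i => borel (X i))).
apply: (gamma_star_ae mc hPhi dPsi mew mu (fun i => ae_impl (uw i) (fun x => @esym _ _ _)) _).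
exact: gE.
Qed.

(** The marginal condition alone makes the potentials essentially bounded. Passing to the bounded
    versions [w] settles every integrability question. *)
Lemma gamma_star_bounded u g :
  (forall i, measurable_fun [set: borel (X i)] (u i)) ->
  (forall i x, u i x < +oo) -> couplings rho g ->
  is_gamma_star c eps Phi rho u g ->
  exists K : R, exists w, [/\ forall i, measurable_fun [set: borel (X i)] (w i),
    forall i x, (`|w i x| <= K)%R &
    forall i, {ae rho i, forall x, u i x = emb w i x}].
Proof.
move=> mu uy cg gs.
pose w0 i := fine \o u i.
have mw0 i : measurable_fun [set: borel (X i)] (w0 i) by exact: measurableT_comp.
have uw0 i : {ae rho i, forall x, u i x = emb w0 i x}.
  (* Where [u i] is [-oo] so is the slack, and [Psi'] is 0 there by definition; [g] thus gives no
     mass to the cylinder, whose mass is that of its base under [rho i]. *)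
  exists [set x | u i x = -oo]; split.
  - have := mu i measurableT [set -oo] (emeasurable_set1 _).
    by rewrite setTI.
  - rewrite -cg; last first.
      by have := mu i measurableT [set -oo] (emeasurable_set1 _); rewrite setTI.
    rewrite gs; last first.
      apply: (@measurable_cylinder N _ (fun i => borel (X i))).
      by have := mu i measurableT [set -oo] (emeasurable_set1 _); rewrite setTI.
    apply: integral0_eq => x /= ux.
    by rewrite /slack (bigD1 i)//= ux !addNye gt0_mulNye ?lte_fin ?invr_gt0.
  - by move=> x /=; rewrite /emb /w0 /=; case: (u i x) (uy i x).
have marg w : (forall i, measurable_fun [set: borel (X i)] (w i)) ->
    (forall i, {ae rho i, forall x, u i x = emb w i x}) ->
    forall i (A : set (borel (X i))), measurable A ->
    \int[rhoN]_(x in [set x | A (x i)]) (dpsi (rsl w x))%:E = rho i A.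
  move=> mw uw i A mA; rewrite -cg//.
  have mew j : measurable_fun [set: borel (X j)] (emb w j) by exact/measurable_EFinP.
  rewrite (gamma_star_ae mc hPhi dPsi mu mew uw gs); last first.
    exact: (@measurable_cylinder N _ (fun i => borel (X i))).
  by apply: eq_integral => x _; rewrite slack_emb.
have /choice[k hk] : forall i, exists k : R, {ae rho i, forall x, (w0 i x <= k)%R}.
  by move=> i; apply: (essentially_bounded_above eps0 mc cM hPhi dPsi mw0) => A mA; rewrite marg.
pose K := (\sum_i `|k i|)%R.
have kK i : (k i <= K)%R.
  by rewrite (le_trans (ler_norm _))// /K (bigD1 i)//= lerDl sumr_ge0.
pose w1 i x := Num.min (w0 i x) K.
have mw1 i : measurable_fun [set: borel (X i)] (w1 i).
  by apply: measurable_minr => //; exact: measurable_cst.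
have uw1 i : {ae rho i, forall x, u i x = emb w1 i x}.
  have H : {ae rho i, forall x, u i x = emb w0 i x /\ (w0 i x <= k i)%R}.
    exact: ae_and (uw0 i) (hk i).
  apply: (ae_impl H) => x [-> wk]; rewrite /emb /w1 min_l//.
  exact: le_trans (kK i).
have wK i x : (w1 i x <= K)%R by rewrite /w1 ge_min lexx orbT.
have /choice[l hl] : forall i, exists l : R, {ae rho i, forall x, (l <= w1 i x)%R}.
  by move=> i; apply: (essentially_bounded_below eps0 mc cM hPhi dPsi mw1 wK) => A mA; rewrite marg.
pose L := (\sum_i `|l i|)%R.
have lL i : (- L <= l i)%R.
  rewrite lerNl (le_trans (ler_norm _))// normrN /L (bigD1 i)//= lerDl.
  by rewrite sumr_ge0.
have K0 : (0 <= K)%R by rewrite sumr_ge0.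
have L0 : (0 <= L)%R by rewrite sumr_ge0.
exists (K + L)%R, (fun i x => Num.max (w1 i x) (- L)%R); split.
- by move=> i; apply: measurable_maxr => //; exact: measurable_cst.
- move=> i x; rewrite ler_norml; apply/andP; split.
    by rewrite le_max opprD gerDr oppr_le0 K0 orbT.
  rewrite ge_max; apply/andP; split; last by rewrite (le_trans _ (addr_ge0 K0 L0))// oppr_le0.
  by rewrite (le_trans (wK i x))// lerDl.
- move=> i; have H : {ae rho i, forall x, u i x = emb w1 i x /\ (l i <= w1 i x)%R}.
    exact: ae_and (uw1 i) (hl i).
  apply: (ae_impl H) => x [-> lw]; rewrite /emb max_l//.
  exact: le_trans (lL i) _.
Qed.

Lemma bounded_optimality u w (K : R) :
  (forall i, measurable_fun [set: borel (X i)] (u i)) ->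
  (forall i, measurable_fun [set: borel (X i)] (w i)) ->
  (forall i x, (`|w i x| <= K)%R) ->
  (forall i, {ae rho i, forall x, u i x = emb w i x}) ->
  dual c eps Phi rho u \is a fin_num /\
  forall g, couplings rho g ->
    primal c eps Phi rho g = dual c eps Phi rho u <-> is_gamma_star c eps Phi rho u g.
Proof.
move=> mu mw wK uw.
have mew i : measurable_fun [set: borel (X i)] (emb w i) by exact/measurable_EFinP.
have iw i := bounded_integrable (mw i) (@wK i).
have ip := bounded_psi_integrable mw wK.
have wu i : {ae rho i, forall x, emb w i x = u i x}.
  by apply: (ae_impl (uw i)) => x ->.
rewrite (dual_ae eps mc hPhi dPsi mu mew uw); split; first exact: dual_emb_fin_num.
move=> g cg; split=> [gd|gs].
  apply: (gamma_star_ae mc hPhi dPsi mew mu wu).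
  exact: optimal_gamma_star.
apply: gamma_star_optimal => //.
exact: (gamma_star_ae mc hPhi dPsi mu mew uw).
Qed.

End optimality.

(** * The equivalences *)

Section equivalences.
Context {R : realType} {N : nat} {X : 'I_N -> completeMetricType R}.
Variables (c : (forall i, X i) -> R) (eps : R) (Phi : \bar R -> \bar R).
Variable rho : forall i, probability (borel (X i)) R.
Local Open Scope ereal_scope.

Local Notation XN := (prod_space (fun i => borel (X i))).
Local Notation rhoN := (product_prob rho).
Local Notation is_pot := (potentials eps Phi rho).
Local Notation is_max := (dual_maximizer c eps Phi rho).
Local Notation gamma := (is_gamma_star c eps Phi rho).

Hypothesis eps0 : (0 < eps)%R.
Hypothesis mc : measurable_fun [set: XN] c.
Variable M : R.
Hypothesis cM : forall x, (`|c x| <= M)%R.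
Hypothesis hPhi : is_entropy Phi.
Hypothesis dPsi :
  forall s : R, derivable (fun r : R => fine (conjugate Phi r%:E)) s 1.

Implicit Types (u v : forall i, X i -> \bar R) (g : probability XN R).

Lemma dual_le_OT u : (forall i, is_pot (u i)) ->
  dual c eps Phi rho u <= OT c eps Phi rho.
Proof.
move=> hu; apply: le_ereal_inf_tmp => _ [g cg <-].
exact: weak_duality_potentials.
Qed.

Lemma gamma_star_dual u g : (forall i, is_pot (u i)) -> couplings rho g ->
  gamma u g ->
  dual c eps Phi rho u \is a fin_num /\
  forall h, couplings rho h ->
    primal c eps Phi rho h = dual c eps Phi rho u <-> gamma u h.
Proof.
move=> hu cg gs.
have mu i : measurable_fun [set: borel (X i)] (u i) by case: (hu i).
have uy i x : u i x < +oo by case: (hu i).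
have [K [w [mw wK uw]]] := gamma_star_bounded eps0 mc cM hPhi dPsi mu uy cg gs.
exact: (bounded_optimality eps0 mc cM hPhi dPsi mu mw wK uw).
Qed.

Lemma gamma_star_minimizer u g : (forall i, is_pot (u i)) -> couplings rho g ->
  gamma u g -> primal_minimizer c eps Phi rho g.
Proof.
move=> hu cg gs; split=> // h ch.
have [_ H] := gamma_star_dual hu cg gs.
rewrite ((H g cg).2 gs); exact: weak_duality_potentials.
Qed.

Lemma OT_gamma_star u g : (forall i, is_pot (u i)) -> couplings rho g ->
  gamma u g -> OT c eps Phi rho = dual c eps Phi rho u.
Proof.
move=> hu cg gs; apply/eqP; rewrite eq_le dual_le_OT// andbT.
have [_ H] := gamma_star_dual hu cg gs; rewrite -((H g cg).2 gs).
by apply: ereal_inf_lbound; exists g.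
Qed.

Lemma OT_dual_maximizer u : (forall i, is_pot (u i)) ->
  OT c eps Phi rho = dual c eps Phi rho u -> is_max u.
Proof.
move=> hu uO; split=> [|v hv]; first exact: hu.
by rewrite -uO; exact: dual_le_OT.
Qed.

Lemma dfwith_id u i : dfwith u i (u i) = u.
Proof.
apply: functional_extensionality_dep => j.
by have [ij|ij] := eqVneq i j; [subst j; rewrite dfwithin|rewrite dfwithout].
Qed.

(** A maximizer does at least as well as the constants of [dual_attainable], so its dual value is
    not [-oo]. *)
Lemma dual_maximizer_coupling u : (0 < N)%N -> is_max u ->
  exists2 g, couplings rho g & gamma u g.
Proof.
move=> hN [hu umax]; apply: (maximal_coupling eps0 mc cM hPhi dPsi hN hu).
  have [v hv vN] := dual_attainable rho eps0 mc cM hPhi dPsi.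
  exact: lt_le_trans vN (umax _ hv).
by move=> i v hv; apply: umax => j; case: dfwithP.
Qed.

(** The two densities agree almost everywhere. Where they are positive the slacks agree, hence [v]
    and [u i] do, the other potentials being shared. So the cylinder over the set where [v] and
    [u i] differ is null for [g], and its base is null for [rho i]. *)
Lemma gamma_star_inj u i (v : X i -> \bar R) g :
  (forall j, is_pot (u j)) -> is_pot v -> couplings rho g ->
  gamma u g -> gamma (dfwith u i v) g -> {ae rho i, forall x, v x = u i x}.
Proof.
move=> hu hv cg gu gv; set u' := dfwith u i v in gv *.
have hu' j : is_pot (u' j) by rewrite /u'; case: dfwithP.
have mu j : measurable_fun [set: borel (X j)] (u j) by case: (hu j).
have mu' j : measurable_fun [set: borel (X j)] (u' j) by case: (hu' j).
have uy j x : u j x < +oo by case: (hu j).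
have uy' j x : u' j x < +oo by case: (hu' j).
have mv : measurable_fun [set: borel (X i)] v by case: hv.
have [K [w [mw wK uw]]] := gamma_star_bounded eps0 mc cM hPhi dPsi mu uy cg gu.
have [K' [w' [mw' wK' uw']]] := gamma_star_bounded eps0 mc cM hPhi dPsi mu' uy' cg gv.
have mD := measurable_density eps mc hPhi dPsi mu.
have mD' := measurable_density eps mc hPhi dPsi mu'.
have DE : ae_eq rhoN setT (conjugate' Phi \o slack c eps u)
    (conjugate' Phi \o slack c eps u').
  apply: integral_ae_eq => //.
    apply/integrableP; split => //.
    under eq_integral => x _ do rewrite /= gee0_abs ?(conjugate'e_ge0 hPhi dPsi)//.
    by rewrite -gu// (le_lt_trans (@probability_le1 _ _ _ g _ _))// ltry.
  by move=> A _ mA; rewrite -[LHS]gu// -[RHS]gv.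
pose A : set (borel (X i)) := [set x | v x != u i x].
have mA : measurable A.
  by have := measurable_neqe measurableT mv (mu i); rewrite setTI.
exists A; split => //; last by move=> x /= /eqP.
rewrite -cg// gu//; last exact: (@measurable_cylinder N _ (fun i => borel (X i))).
rewrite (ae_eq_integral (cst 0))//; first exact: integral0.
- exact: (@measurable_cylinder N _ (fun i => borel (X i))).
- exact: measurable_funTS.
have aew := @ae_forall_fin _ _ _ rhoN _ _ (fun j => coord_ae (uw j)).
have aew' := @ae_forall_fin _ _ _ rhoN _ _ (fun j => coord_ae (uw' j)).
apply: (ae_impl (ae_and DE (ae_and aew aew'))) => x [+ [xw xw']] Ax.
have slE (f : forall j, X j -> \bar R) (r : forall j, X j -> R) :
    (forall j, f j (x j) = emb r j (x j)) -> slack c eps f x = (rslack c eps r x)%:E.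
  move=> fr; rewrite -slack_emb /slack; congr ((_ - _) * _).
  by apply: eq_bigr => j _.
move=> /(_ I) /=; rewrite (slE _ _ xw) (slE _ _ xw') /= => -[dE].
congr EFin; apply/eqP/negPn/negP => d0.
have {d0} : (0 < derive1 (fun r : R => fine (conjugate Phi r%:E)) (rslack c eps w x))%R.
  by rewrite lt_def d0 (conjugate'_ge0 hPhi dPsi).
move=> /(conjugate'_inj hPhi dPsi) /(_ dE); rewrite /rslack => ss.
have e0 : (eps^-1 != 0)%R by rewrite invr_eq0 gt_eqF.
move: ss => /(mulIf e0)/addIr; rewrite (bigD1 i)//= [X in _ = X](bigD1 i)//=.
rewrite (eq_bigr (fun j => w' j (x j))); last first.
  move=> j ji; have := xw j; have := xw' j.
  by rewrite /u' dfwithout 1?eq_sym// => -> [].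
move=> /addIr ww.
have vx : v (x i) = u i (x i).
  have vw : v (x i) = emb w' i (x i) by have := xw' i; rewrite /u' dfwithin.
  by apply: (etrans vw); rewrite xw /emb ww.
by move: Ax => /=; rewrite /A /= vx eqxx.
Qed.

(** The selected [v] need not be [u i] a priori, but [dfwith u i v] is again a maximizer. Its
    coupling [g'] attains the same dual value, so [g'] is also the coupling of [u], and
    [gamma_star_inj] concludes. *)
Lemma maximizer_transform u g : (0 < N)%N -> is_max u -> couplings rho g -> gamma u g ->
  forall i, {ae rho i, forall x, transform c eps Phi rho i u x = u i x} /\
    Lnorm (rho i) +oo (u i) < +oo.
Proof.
move=> hN umax cg gu i; have [hu um] := umax.
have [dfin uniq] := gamma_star_dual hu cg gu.
split; last first.
  have mu j : measurable_fun [set: borel (X j)] (u j) by case: (hu j).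
  have uy j x : u j x < +oo by case: (hu j).
  have [K [w [mw wK uw]]] := gamma_star_bounded eps0 mc cM hPhi dPsi mu uy cg gu.
  rewrite unlock /=; case: ifPn => // _; apply: (@le_lt_trans _ _ K%:E); last exact: ltry.
  apply/ess_supP; apply: (ae_impl (uw i)) => x ux /=.
  by rewrite ux /= lee_fin.
have : partial_argmax c eps Phi rho i u (transform c eps Phi rho i u).
  rewrite /transform; apply: xgetPex; exists (u i).
  split=> [|v hv]; first exact: hu.
  by rewrite dfwith_id; apply: um => j; case: dfwithP.
set v := transform _ _ _ _ _ _; move=> [hv /(_ _ (hu i))]; rewrite dfwith_id => dv.
have hu' j : is_pot (dfwith u i v j) by case: dfwithP.
have dE : dual c eps Phi rho (dfwith u i v) = dual c eps Phi rho u.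
  by apply/eqP; rewrite eq_le dv andbT; exact: um.
have u'max : is_max (dfwith u i v)
  by split=> [|z hz]; [exact: hu'|rewrite dE; exact: um].
have [g' cg' gu'] := dual_maximizer_coupling hN u'max.
apply: (gamma_star_inj hu hv cg' _ gu').
apply/uniq => //; rewrite -dE.
by have [_ H] := gamma_star_dual hu' cg' gu'; apply/H.
Qed.

(** Boundedness makes the dual value finite, and agreement with the transform makes each [u i] a
    maximizer in its own coordinate, which is all that [maximal_coupling] requires. *)
Lemma transform_coupling u : (0 < N)%N -> (forall i, is_pot (u i)) ->
  (forall i, {ae rho i, forall x, transform c eps Phi rho i u x = u i x} /\
    Lnorm (rho i) +oo (u i) < +oo) ->
  exists2 g, couplings rho g & gamma u g.
Proof.
move=> hN hu tu.
have mu i : measurable_fun [set: borel (X i)] (u i) by case: (hu i).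
have bu i : exists r : R, {ae rho i, forall x, `|u i x| <= r%:E}.
  have [_] := tu i; rewrite unlock /= probability_setT lte01 => uy.
  have [r _ ur] : exists2 r : R, (0 <= r)%R & ess_sup (rho i) (abse \o u i) <= r%:E.
    move: uy; case: (ess_sup _ _) => [r _|//|_].
      by exists `|r|%R => //; rewrite lee_fin ler_norm.
    by exists 0%R => //; rewrite leNye.
  by exists r; move/ess_supP : ur.
have /choice[k hk] := bu.
pose K := (\sum_i `|k i|)%R.
have K0 : (0 <= K)%R by rewrite sumr_ge0.
have kK i : (k i <= K)%R.
  by rewrite (le_trans (ler_norm _))// /K (bigD1 i)//= lerDl sumr_ge0.
pose w i x := Num.max (Num.min (fine (u i x)) K) (- K)%R.
have mw i : measurable_fun [set: borel (X i)] (w i).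
  apply: measurable_maxr; last exact: measurable_cst.
  apply: measurable_minr; last exact: measurable_cst.
  exact: measurableT_comp.
have wK i x : (`|w i x| <= K)%R.
  rewrite ler_norml le_max lexx orbT /= ge_max ge_min lexx orbT /=.
  by rewrite (le_trans _ K0)// oppr_le0.
have uw i : {ae rho i, forall x, u i x = emb w i x}.
  apply: (ae_impl (hk i)) => x; rewrite /emb /w.
  case: (u i x) => [r| |]//=; rewrite lee_fin => rk.
  have : (`|r| <= K)%R by exact: le_trans (kK i).
  by rewrite ler_norml => /andP[r1 r2]; rewrite min_l// max_l.
have [dfin _] := bounded_optimality eps0 mc cM hPhi dPsi mu mw wK uw.
apply: (maximal_coupling eps0 mc cM hPhi dPsi hN hu).
  by move: dfin; rewrite fin_numElt => /andP[].
move=> i v hv; have [tui _] := tu i.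
have [[z hz]|no] := pselect (exists z, partial_argmax c eps Phi rho i u z).
  have [ht /(_ _ hv)] : partial_argmax c eps Phi rho i u (transform c eps Phi rho i u).
    by apply: xgetPex; exists z.
  move=> /le_trans; apply.
  rewrite le_eqVlt; apply/orP; left; apply/eqP; apply: (dual_ae eps mc hPhi dPsi) => //.
    by move=> j; case: dfwithP => //; case: ht.
  move=> j; have [ij|ij] := eqVneq i j; last by rewrite dfwithout//; apply: aeW.
  by subst j; rewrite dfwithin.
(* An empty argmax makes the transform [-oo], which cannot agree almost everywhere with the bounded
   [u i] under a probability measure. *)
have tE : transform c eps Phi rho i u = fun=> -oo.
  by apply: xgetPN => z hz; apply: no; exists z.
have : {ae rho i, forall x, False}.
  apply: (ae_impl (ae_and tui (hk i))) => x [<-].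
  by rewrite tE.
move=> [S [mS S0 /= FS]]; exfalso.
have /eqP := probability_setT (rho i).
rewrite (_ : setT = S); first by rewrite S0 eq_sym onee_eq0.
by apply/seteqP; split=> // x _; apply: FS.
Qed.

End equivalences.

Unset Implicit Arguments.

Local Open Scope ereal_scope.

Theorem theoremE1 (R : realType) (N : nat) (hN : (0 < N)%N) (eps : R)
  (heps : (0 < eps)%R)
  (X : 'I_N -> completeMetricType R) (hX : forall i, separable (X i))
  (c : (forall i, X i) -> R)
  (c_measurable :
    measurable_fun [set: prod_space (fun i => borel (X i))] c)
  (c_bounded : exists M : R, forall x, (`|c x| <= M)%R)
  (Phi : \bar R -> \bar R) (hPhi : is_entropy Phi)
  (hPsi : forall s : R, derivable (fun r : R => fine (conjugate Phi r%:E)) s 1)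
  (rho : forall i, probability (borel (X i)) R)
  (u : forall i, X i -> \bar R) (hu : forall i, potentials eps Phi rho (u i)) :
  [<-> dual_maximizer c eps Phi rho u;
       forall i,
         {ae rho i, forall x, transform c eps Phi rho i u x = u i x} /\
         Lnorm (rho i) +oo (u i) < +oo;
       exists2 g, couplings rho g & is_gamma_star c eps Phi rho u g;
       OT c eps Phi rho = dual c eps Phi rho u] /\
  (dual_maximizer c eps Phi rho u ->
     exists g, [/\ is_gamma_star c eps Phi rho u g,
       primal_minimizer c eps Phi rho g &
       forall h, primal_minimizer c eps Phi rho h ->
         forall A : set (prod_space (fun i => borel (X i))),
           measurable A -> h A = g A]).
Proof.
have [M cM] := c_bounded; split.
  tfae.
  - move=> umax.
    have [g cg gu] := dual_maximizer_coupling heps c_measurable cM hPhi hPsi hN umax.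
    exact: (maximizer_transform heps c_measurable cM hPhi hPsi hN umax cg gu).
  - exact: (transform_coupling heps c_measurable cM hPhi hPsi hN hu).
  - by move=> [g cg gu]; exact: (OT_gamma_star heps c_measurable cM hPhi hPsi hu cg gu).
  - exact: (OT_dual_maximizer heps c_measurable cM hPhi hPsi hu).
move=> umax.
have [g cg gu] := dual_maximizer_coupling heps c_measurable cM hPhi hPsi hN umax.
have gmin := gamma_star_minimizer heps c_measurable cM hPhi hPsi hu cg gu.
exists g; split=> // h [ch hmin] A mA.
have [_ H] := gamma_star_dual heps c_measurable cM hPhi hPsi hu cg gu.
(* A second minimizer has the same primal value, which is the dual value of [u]; its density is
   therefore that of [g]. *)
have gh : primal c eps Phi rho h = primal c eps Phi rho g.
  by apply/eqP; rewrite eq_le; apply/andP; split; [exact: hmin|exact: (gmin.2 h ch)].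
have hu' : is_gamma_star c eps Phi rho u h by apply/H => //; rewrite gh; apply/H.
by rewrite hu'// gu.
Qed.
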